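(* For $0<\alpha<1$ and $\beta>0$, as $N\to\infty$, $$\frac1{b_N}\ln Z_N\stackrel{d}{\to}\beta\sum_{j=1}^\infty\gamma_j^{-1/\alpha},$$ where the infinite sum on the right-hand side is finite almost surely.
   Context: Lévy spin glass model. Let $0<\alpha<1$ and let $X$ be a symmetric real random variable with $\mathbb P(|X|>x)=L(x)/x^\alpha$ for all $x>0$, where $L:(0,\infty)\to(0,\infty)$ is slowly varying at $\infty$, i.e. $\lim_{x\to\infty}L(tx)/L(x)=1$ for every $t>0$. For $N\ge1$ set $a_N=\inf\{x>0: N\,\mathbb P(|X|>x)\le 1\}$ and $J=a_N^{-1}X$ ($a_N>0$ for all large $N$, and only large $N$ matter). Let $(J_{ij})_{1\le i<j\le N}$ be i.i.d. copies of $J$ and $Z_N=\sum_{\sigma\in\{-1,1\}^N}\exp\bigl(\beta\sum_{1\le i<j\le N}J_{ij}\sigma_i\sigma_j\bigr)$. Set $b_N=a_N^{-1}a_{\binom N2}$. Let $E_1,E_2,\ldots$ be i.i.d. exponential random variables with rate one and $\gamma_j=E_1+\cdots+E_j$ for $j\ge1$. The symbol $\stackrel{d}{\to}$ denotes convergence in distribution. *)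

(* Defs.v *)
From HB Require Import structures.
From mathcomp Require Import all_boot all_order all_algebra.
From mathcomp Require Import all_classical all_reals all_analysis.
From mathcomp Require Import measurable_realfun.

Set Implicit Arguments.
Unset Strict Implicit.
Unset Printing Implicit Defensive.

Import Order.TTheory GRing.Theory Num.Theory.
Import numFieldNormedType.Exports.

Local Open Scope classical_set_scope.
Local Open Scope ring_scope.

Definition slowly_varying (R : realType) (L : R -> R) : Prop :=
  forall t : R, 0 < t -> L (t * x) / L x @[x --> +oo] --> (1 : R).

Definition same_law (R : realType) (d d' : measure_display)
    (T : measurableType d) (T' : measurableType d')
    (P : probability T R) (P' : probability T' R)
    (X : T -> R) (Y : T' -> R) : Prop :=
  forall A : set R, measurable A -> P (X @^-1` A) = P' (Y @^-1` A).

Definition symmetric_law (R : realType) (d : measure_display)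
    (T : measurableType d) (P : probability T R) (X : T -> R) : Prop :=
  same_law P P X (fun w => - X w).

Definition mutually_independent (R : realType) (d : measure_display)
    (T : measurableType d) (P : probability T R) (I : choiceType)
    (D : set I) (X : I -> {RV P >-> R}) : Prop :=
  forall (s : seq I) (A : I -> set R), uniq s -> [set` s] `<=` D ->
    (forall i, measurable (A i)) ->
    P (\bigcap_(i in [set` s]) (X i @^-1` A i)) =
    (\prod_(i <- s) P (X i @^-1` A i))%E.

Definition cvg_in_distribution (R : realType)
    (d : nat -> measure_display) (T : forall n, measurableType (d n))
    (P : forall n, probability (T n) R)
    (d' : measure_display) (T' : measurableType d') (P' : probability T' R)
    (Y : forall n, {RV (P n) >-> R}) (Y' : {RV P' >-> R}) : Prop :=
  forall f : R -> R, continuous f -> bounded_fun f ->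
    ('E_(P n)[f \o Y n])%E @[n --> \oo] --> ('E_P'[f \o Y'])%E.

(* a_N; the infimum is taken in R, and equals 0 for N <= 1. *)
Definition scaling (R : realType) (d : measure_display)
    (T : measurableType d) (P : probability T R) (X : T -> R) (N : nat) : R :=
  inf [set x : R | 0 < x /\ (N%:R%:E * P [set w | (x < `|X w|)%R] <= 1)%E].

(* b_N *)
Definition scaling_ratio (R : realType) (d : measure_display)
    (T : measurableType d) (P : probability T R) (X : T -> R) (N : nat) : R :=
  (scaling P X N)^-1 * scaling P X 'C(N, 2).

(* Only the entries of J above the diagonal are used. A configuration is a
   boolean function s, the spin at site i being (-1) ^+ s i. *)
Definition partition_function (R : realType) (N : nat) (beta : R)
    (J : 'I_N -> 'I_N -> R) : R :=
  \sum_(s : {ffun 'I_N -> bool})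
    expR (beta * \sum_(i < N) \sum_(j < N | (i < j)%N)
      J i j * (-1) ^+ s i * (-1) ^+ s j).

Section normalized_log_partition.
Context (R : realType) (d : measure_display) (T : measurableType d)
  (P : probability T R) (N : nat) (b beta : R)
  (J : 'I_N -> 'I_N -> {RV P >-> R}).

Definition normalized_log_partition (w : T) : R :=
  b^-1 * ln (partition_function beta (fun i j => J i j w)).

Lemma measurable_normalized_log_partition :
  measurable_fun [set: T] normalized_log_partition.
Proof.
apply: measurable_funM => //; apply: measurableT_comp => //.
apply: measurable_sum => s; apply: measurableT_comp => //.
apply: measurable_funM => //; apply: measurable_sum => i.
rewrite (_ : (fun w => _) = fun w => \sum_(j < N)
    if (i < j)%N then J i j w * (-1) ^+ s i * (-1) ^+ s j else 0); last first.
  by apply/funext => w; rewrite big_mkcond.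
apply: measurable_sum => j; case: (i < j)%N => //.
by apply: measurable_funM => //; apply: measurable_funM.
Qed.

HB.instance Definition _ := isMeasurableFun.Build _ _ _ _
  normalized_log_partition measurable_normalized_log_partition.

End normalized_log_partition.

Section gamma_series.
Context (R : realType) (d : measure_display) (T : measurableType d)
  (P : probability T R) (alpha : R) (E : nat -> {RV P >-> R}).

(* Indices start at 0: E j stands for E_{j+1}, and arrival_time j for
   gamma_{j+1}. *)
Definition arrival_time (j : nat) (w : T) : R := \sum_(i < j.+1) E i w.

(* The series with value in [0, +oo]. It differs from the mathematical one only
   where some arrival time is <= 0 (powR is total), an event of probability 0
   for exponential variables. *)
Definition gamma_series (w : T) : \bar R :=
  (\sum_(0 <= j <oo) (arrival_time j w `^ (- alpha^-1))%:E)%E.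

Definition scaled_gamma_series (beta : R) (w : T) : R :=
  beta * fine (gamma_series w).

Lemma measurable_scaled_gamma_series (beta : R) :
  measurable_fun [set: T] (scaled_gamma_series beta).
Proof.
apply: measurable_funM => //; apply: measurableT_comp => //.
apply: ge0_emeasurable_sum => [k w _ _|k _]; first by rewrite lee_fin powR_ge0.
apply/measurable_EFinP; apply: (measurableT_comp (measurable_powR _)).
exact: measurable_sum.
Qed.

HB.instance Definition _ (beta : R) := isMeasurableFun.Build _ _ _ _
  (scaled_gamma_series beta) (measurable_scaled_gamma_series beta).

End gamma_series.

(* Main.v *)
Require Import Defs.
From HB Require Import structures.
From mathcomp Require Import all_boot all_order all_algebra.
From mathcomp Require Import all_classical all_reals all_analysis.
From mathcomp Require Import measurable_realfun.
From mathcomp Require Import ring lra zify.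

(** The couplings have infinite mean, so the sum [S] of their absolute values is
    carried by a few of its terms. On the scale [b] of the largest one, the
    theorem amounts to two facts: [ln Z] is [beta * S] up to an error that is
    negligible against [b], and [S / b] converges in distribution to the gamma
    series.

    For the first fact, no configuration has energy above [S], whence
    [ln Z <= N * ln 2 + beta * S], and [N / b] tends to [0] because [alpha < 1]
    ([scale_ratio_cvg]). In the other direction, it is unlikely that two
    couplings above [eps * b] sit on edges that meet: there are of order [N ^ 3]
    such pairs of edges, and each exceedance has probability of order [N ^ -2]
    ([integral_collisions]). Otherwise some configuration satisfies all large
    couplings at once ([satisfy_large]), and it loses at most twice the sum of
    the small ones, a sum of order [eps ^ (1 - alpha) * b]. This is
    [laplace_comparison], where the two Laplace transforms are compared at fixed
    [N].

    For the second fact, the Laplace transform of [S / b] at [t] is the [M]-th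
    power, [M = 'C(N, 2)], of that of one coupling. The layer-cake formula turns
    [M * (1 - E exp (- t * |X| / a_M))] into an integral of scaled tails
    [M * P (|X| > a_M * y)], which converge to [y ^ (- alpha)] by regular
    variation and are dominated by Potter's bound. Hence the transform tends to
    [exp (- c_t)], with [c_t] given by [levy_exponent] ([laplace_tail_cvg]). That
    the gamma series has the same transform, and is finite, follows from a
    martingale: for the weight [w r = exp (- t * r ^ (- 1 / alpha))] and the
    primitive [K] of [1 - w], the product of [w (gamma_j)] over [j <= n] times
    [exp (K gamma_n)] has mean one, and [K] tends to [c_t]
    ([cvg_integral_arrival_product]).

    Both variables being nonnegative, convergence of Laplace transforms at the
    positive integers gives convergence in distribution: it is convergence of the
    moments of [exp (- Y)] on [[0, 1]] ([cvg_in_distribution_laplace]). *)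

Set Implicit Arguments.
Unset Strict Implicit.
Unset Printing Implicit Defensive.

Import Order.TTheory GRing.Theory Num.Theory.
Import numFieldNormedType.Exports.

Local Open Scope classical_set_scope.
Local Open Scope ring_scope.

(** * Layer cake and densities *)

Lemma eq_indic (R : pzRingType) (T U : Type) (A : set T) (B : set U) x y :
  (A x <-> B y) -> \1_A x = \1_B y :> R.
Proof.
move=> AB; rewrite !indicE.
suff -> : (x \in A) = (y \in B) by [].
by apply/idP/idP; rewrite !inE => /AB.
Qed.

Section layer_cake.
Context (R : realType) (d : measure_display) (T : measurableType d) (f : T -> R).
Hypothesis mf : measurable_fun [set: T] f.

Definition subgraph : set (T * measurableTypeR R) :=
  [set p | 0 < p.2 < f p.1].

Lemma measurable_subgraph : measurable subgraph.
Proof.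
rewrite (_ : subgraph =
  (fun p : T * measurableTypeR R => (0 < p.2)%R && (p.2 < f p.1)%R) @^-1`
    [set true]); last by apply/seteqP; split.
rewrite -[X in measurable X]setTI.
have : measurable_fun [set: T * measurableTypeR R]
    (fun p => (0 < p.2)%R && (p.2 < f p.1)%R).
  apply: measurable_and.
    exact: measurable_fun_ltr.
  apply: measurable_fun_ltr => //.
  exact: measurableT_comp.
exact.
Qed.

Lemma measurable_superlevel (u : R) : measurable [set x | u < f x].
Proof.
rewrite -[X in measurable X]setTI.
rewrite (_ : [set x | _] = f @^-1` `]u, +oo[%classic); first exact: mf.
by apply/seteqP; split => x /=; rewrite in_itv/= andbT.
Qed.

Hypothesis f0 : forall x, 0 <= f x.

Let mu := @lebesgue_measure R.

Lemma integral_subgraph x :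
  (\int[mu]_u (\1_subgraph (x, u))%:E = (f x)%:E)%E.
Proof.
transitivity (\int[mu]_u (\1_(`]0%R, f x[%classic : set R) u)%:E)%E.
  by apply: eq_integral => u _; congr EFin; apply: eq_indic; rewrite /= in_itv.
rewrite integral_indic//= setIT /mu lebesgue_measure_itv/= lte_fin.
by have := f0 x; rewrite le_eqVlt => /predU1P[<-|->]; rewrite ?ltxx ?sube0.
Qed.

(** Tonelli's theorem for the indicator of the subgraph of [f]. *)
Lemma layer_cake (m : {sigma_finite_measure set T -> \bar R}) :
  (\int[m]_x (f x)%:E =
   \int[mu]_(u in `]0%R, +oo[) m [set x | (u < f x)%R])%E.
Proof.
under eq_integral do rewrite -integral_subgraph.
rewrite (fubini_tonelli (m1 := m) (m2 := mu)
  (fun p => (\1_subgraph p)%:E))//=; last first.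
  by apply/measurable_EFinP; apply: measurable_indic; exact: measurable_subgraph.
rewrite [RHS]integral_mkcond; apply: eq_integral => u _.
rewrite patchE; case: ifPn => [|]; rewrite ?inE ?notin_setE /= in_itv/= andbT => u0.
  rewrite (eq_integral (fun x => (\1_[set x | u < f x] x)%:E)); last first.
    by move=> x _; congr EFin; apply: eq_indic; rewrite /subgraph/= u0.
  by rewrite integral_indic ?setIT//; exact: measurable_superlevel.
apply: integral0_eq => x _; rewrite indicE memNset//= => /andP[].
by move/negP: u0 => /negbTE ->.
Qed.

(** The layer-cake formula turns the density property from sets to functions. *)
Lemma ge0_integral_density (m n : {sigma_finite_measure set T -> \bar R})
    (p : T -> R) :
  measurable_fun [set: T] p -> (forall x, 0 <= p x) ->
  (forall A, measurable A -> n A = \int[m]_(x in A) (p x)%:E)%E ->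
  (\int[n]_x (f x)%:E = \int[m]_x (f x * p x)%:E)%E.
Proof.
move=> mp p0 nE.
pose F (q : T * measurableTypeR R) : \bar R := (p q.1 * \1_subgraph q)%:E.
have mF : measurable_fun [set: T * measurableTypeR R] F.
  apply/measurable_EFinP; apply: measurable_funM.
    exact: measurableT_comp.
  by apply: measurable_indic; exact: measurable_subgraph.
have F0 q : (0 <= F q)%E by rewrite lee_fin mulr_ge0.
transitivity (\int[m]_x \int[mu]_u (F (x, u)))%E; last first.
  apply: eq_integral => x _; rewrite mulrC EFinM -integral_subgraph.
  rewrite -ge0_integralZl_EFin//.
  apply: (measurable_fun_pair2 (f := fun q => (\1_subgraph q)%:E)).
  by apply/measurable_EFinP; apply: measurable_indic; exact: measurable_subgraph.
rewrite (fubini_tonelli (m1 := m) (m2 := mu))// layer_cake.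
rewrite integral_mkcond; apply: eq_integral => u _; rewrite patchE.
case: ifPn => [|]; rewrite ?inE ?notin_setE /= in_itv/= andbT => u0.
  rewrite nE; last exact: measurable_superlevel.
  rewrite integral_mkcond; apply: eq_integral => x _; rewrite patchE /F/=.
  rewrite indicE (_ : (_, _) \in _ = (x \in [set x | u < f x])); last first.
    by apply/idP/idP; rewrite !inE /subgraph/= u0.
  by case: ifPn; rewrite ?mulr1 ?mulr0.
apply/esym/integral0_eq => x _; rewrite /F indicE memNset ?mulr0//= => /andP[].
by move/negP: u0 => /negbTE ->.
Qed.

End layer_cake.

(** * Expectations under independence *)

Section independence.
Context (R : realType) (d : measure_display) (T : measurableType d)
  (P : probability T R) (I : choiceType) (D : set I) (X : I -> {RV P >-> R}).
Hypothesis indepX : mutually_independent D X.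

(** A pi-system that generates the sigma-algebra of the [X i] for [i] in [s]. *)
Definition cylinder (s : seq I) : set (set T) :=
  [set B | exists2 A : I -> set R, (forall i, measurable (A i)) &
     B = \bigcap_(i in [set` s]) (X i @^-1` A i)].

Lemma cylinder_setI (s : seq I) : setI_closed (cylinder s).
Proof.
move=> _ _ [A mA ->] [B mB ->]; exists (fun i => A i `&` B i).
  by move=> i; exact: measurableI.
rewrite -bigcapI; apply: eq_bigcapr => i _.
by rewrite preimage_setI.
Qed.

Lemma measurable_cylinder (s : seq I) (B : set T) :
  cylinder s B -> measurable B.
Proof.
move=> [A mA ->]; rewrite bigcap_seq.
apply: bigsetI_measurable => i _; rewrite -[X in measurable X]setTI.
exact: measurable_funPT.
Qed.

Lemma sigma_cylinder_measurable (s : seq I) (B : set T) :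
  <<s cylinder s >> B -> measurable B.
Proof.
move: B; apply: smallest_sub; first exact: sigma_algebra_measurable.
exact: measurable_cylinder.
Qed.

Lemma cylinder_coordinate (s : seq I) (i : I) : i \in s ->
  measurable_fun [set: g_sigma_algebraType (cylinder s)]
    (X i : g_sigma_algebraType (cylinder s) -> R).
Proof.
move=> si _ A mA; rewrite setTI; apply: sub_sigma_algebra.
exists (fun k => if k == i then A else setT).
  by move=> k; case: ifP.
apply/seteqP; split => w /=.
  by move=> Aw k /= ks; case: eqP => [->|].
by move=> /(_ i si); rewrite /= eqxx.
Qed.

(** The events [B] that obey the product rule form a Dynkin system, and cylinders
    are stable under intersection, so the rule extends from cylinders to the
    sigma-algebra that they generate. *)
Lemma independent_sigma_cylinder (s : seq I) (j : I) (B : set T) (A : set R) :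
  uniq s -> j \notin s -> [set` j :: s] `<=` D ->
  <<s cylinder s >> B -> measurable A ->
  (P (B `&` X j @^-1` A) = P B * P (X j @^-1` A))%E.
Proof.
move=> us js sD sB mA; move: B sB.
have mXA : measurable (X j @^-1` A).
  by rewrite -[X in measurable X]setTI; exact: measurable_funPT.
suff : <<s cylinder s >> `<=` [set B | measurable B /\
    (P (B `&` X j @^-1` A) = P B * P (X j @^-1` A))%E].
  by move=> h B /h[].
apply: lambda_system_subset => //; first exact: cylinder_setI.
  apply/dynkin_lambda_system; split.
  - by split => //; rewrite setTI probability_setT mul1e.
  - move=> B [mB PB]; split; first exact: measurableC.
    have mBA : measurable (B `&` X j @^-1` A) by exact: measurableI.
    have -> : P (~` B `&` X j @^-1` A) =
        (P (X j @^-1` A) - P (B `&` X j @^-1` A))%E.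
      rewrite (_ : ~` B `&` _ = X j @^-1` A `\` (B `&` X j @^-1` A)); last first.
        by rewrite setDIr setDv setU0 setDE setIC.
      by rewrite measureD ?ltey_eq ?fin_num_measure// setICA setIid.
    rewrite PB.
    rewrite probability_setC//.
    have [b ->] : exists b, P B = b%:E.
      by exists (fine (P B)); rewrite fineK// fin_num_measure.
    have [a ->] : exists a, P (X j @^-1` A) = a%:E.
      by exists (fine (P (X j @^-1` A))); rewrite fineK// fin_num_measure.
    by rewrite -EFinM -!EFinB -EFinM mulrBl mul1r.
  - move=> F tF mF; split.
      by apply: bigcup_measurable => k _; exact: (mF k).1.
    rewrite setI_bigcupl !measure_bigcup//=.
    + have [a Pa] : exists a, P (X j @^-1` A) = a%:E.
        by exists (fine (P (X j @^-1` A))); rewrite fineK// fin_num_measure.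
      rewrite Pa muleC -nneseriesZl//.
      by apply: eq_eseriesr => k _; rewrite (mF k).2 Pa muleC.
    + by move=> k _; exact: (mF k).1.
    + by move=> k _; apply: measurableI => //; exact: (mF k).1.
    + by apply: trivIset_setIr.
move=> _ [C mC ->]; split; first by apply: (@measurable_cylinder s); exists C.
pose C' i := if i == j then A else C i.
have mC' i : measurable (C' i) by rewrite /C'; case: ifP.
have C'C i : i \in s -> C' i = C i.
  by move=> si; rewrite /C'; case: eqP => // ij; move: js; rewrite -ij si.
have C'j : C' j = A by rewrite /C' eqxx.
have := indepX (s := j :: s) (A := C').
rewrite /= us js big_cons C'j => /(_ isT sD mC') PjC.
rewrite indepX//; last by move=> i /= si; apply: sD; rewrite /= inE si orbT.
rewrite (eq_big_seq (fun i => P (X i @^-1` C' i))); last first.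
  by move=> i si; rewrite C'C.
rewrite muleC -PjC; congr (P _); apply/seteqP; split => w /=.
  move=> [Cw Aw] i /=; rewrite inE => /orP[/eqP ->|si]; first by rewrite C'j.
  by rewrite C'C//; exact: Cw.
move=> Cw; split; last by have := Cw j; rewrite /= C'j inE eqxx; exact.
by move=> i /= si; have := Cw i; rewrite /= C'C// inE si orbT; exact.
Qed.

(** Independence as a Fubini theorem: integrating over a coordinate that does
    not enter [V] amounts to integrating it against its own law. *)
Lemma integral_independent (s : seq I) (j : I) (d2 : measure_display)
    (T2 : measurableType d2) (V : T -> T2) (k : T2 * R -> \bar R) :
  uniq s -> j \notin s -> [set` j :: s] `<=` D ->
  measurable_fun [set: g_sigma_algebraType (cylinder s)]
    (V : g_sigma_algebraType (cylinder s) -> T2) ->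
  measurable_fun [set: T2 * R] k -> (forall q, 0 <= k q)%E ->
  (\int[P]_w k (V w, X j w) =
   \int[P]_w \int[distribution P (X j)]_y k (V w, y))%E.
Proof.
move=> us js sD mVs mk k0.
have mV : measurable_fun [set: T] V.
  move=> _ A mA; have := mVs measurableT A mA.
  by rewrite !setTI; exact: sigma_cylinder_measurable.
pose VX w := (V w, X j w).
have mVX : measurable_fun [set: T] VX by exact: measurable_fun_pair.
pose mVX' : {mfun T >-> (T2 * R)%type} := mfun_Sub (mem_set mVX).
pose mV' : {mfun T >-> T2} := mfun_Sub (mem_set mV).
transitivity (\int[distribution P mVX']_q k q)%E.
  by rewrite ge0_integral_distribution.
transitivity (\int[distribution P mV' \x distribution P (X j)]_q k q)%E.
  apply: eq_measure_integral => /= A mA _; apply/esym.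
  apply: product_measure_unique => //= B C mB mC.
  rewrite /distribution/= /pushforward/=.
  rewrite -(independent_sigma_cylinder (s := s)) //.
  by have := mVs measurableT B mB; rewrite setTI.
rewrite fubini_tonelli1// ge0_integral_distribution//.
- exact: measurable_fun_fubini_tonelli_F.
- by move=> y; apply: integral_ge0.
Qed.

(** By induction on [s]: the product over the tail of [s] is measurable for the
    sigma-algebra of the remaining coordinates. *)
Lemma integral_prod_independent (s : seq I) (f : I -> R -> R) :
  uniq s -> [set` s] `<=` D ->
  (forall i, measurable_fun [set: R] (f i)) -> (forall i x, 0 <= f i x) ->
  (\int[P]_w (\prod_(i <- s) f i (X i w))%:E =
   \prod_(i <- s) \int[P]_w (f i (X i w))%:E)%E.
Proof.
move=> + + mf f0; elim: s => [|j s IH].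
  move=> _ _; rewrite big_nil; under eq_integral do rewrite big_nil.
  by rewrite integral_cst//= mul1e probability_setT.
move=> /= /andP[js us] sD.
have sD' : [set` s] `<=` D.
  by move=> i /= si; apply: sD; rewrite /= inE si orbT.
under eq_integral do rewrite big_cons mulrC.
pose V w := \prod_(i <- s) f i (X i w).
have V0 w : 0 <= V w by apply: prodr_ge0.
have mVs : measurable_fun [set: g_sigma_algebraType (cylinder s)]
    (V : g_sigma_algebraType (cylinder s) -> R).
  apply: measurable_prod => i si; apply: measurableT_comp => //.
  exact: cylinder_coordinate.
(* The integrand must be nonnegative off the range of [V] too, hence the norm. *)
under eq_integral => w _ do rewrite -/(V w) -{1}(ger0_norm (V0 w)).
rewrite (integral_independent (s := s) (j := j) (V := V)
  (k := fun q => (`|q.1| * f j q.2)%:E))//; last 2 first.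
- apply/measurable_EFinP; apply: measurable_funM; apply: measurableT_comp => //.
- by move=> q; rewrite lee_fin mulr_ge0.
rewrite big_cons -IH// muleC.
have mfX : measurable_fun [set: T] (fun w => f j (X j w)).
  exact: measurableT_comp.
rewrite -ge0_integralZr//; last 3 first.
- apply/measurable_EFinP; apply: measurable_prod => i _.
  exact: measurableT_comp.
- by move=> w _; rewrite lee_fin; exact: V0.
- by apply: integral_ge0 => w _; rewrite lee_fin.
apply: eq_integral => w _ /=.
under eq_integral do rewrite EFinM.
rewrite ge0_integralZl_EFin//; last 2 first.
- by move=> y _; rewrite lee_fin.
- exact/measurable_EFinP.
rewrite ger0_norm//; congr (_ * _)%E; apply: ge0_integral_distribution.
  exact/measurable_EFinP.
by move=> y; rewrite lee_fin.
Qed.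

End independence.

(** * Products along exponential arrivals *)

Section exponential_arrivals.
Context (R : realType) (d : measure_display) (T : measurableType d)
  (P : probability T R) (E : nat -> {RV P >-> R}).
Hypothesis Elaw : forall (j : nat) (A : set R), measurable A ->
  distribution P (E j) A = exponential_prob 1 A.
Hypothesis Eindep : mutually_independent [set: nat] E.

Let mu := @lebesgue_measure R.

Lemma integral_exponential_law (n : nat) (f : R -> R) :
  measurable_fun [set: R] f -> (forall x, 0 <= f x) ->
  (\int[distribution P (E n)]_y (f y)%:E =
   \int[mu]_(y in `[0%R, +oo[) (f y * expR (- y))%:E)%E.
Proof.
move=> mf f0.
have pdf0 (x : R) : 0 <= exponential_pdf 1 x by exact: exponential_pdf_ge0.
(* The Borel sets of the reals carry two displays: the law of [E n] is moved to
   the one on which the Lebesgue measure lives. *)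
have mE : measurable_fun [set: T] (E n : T -> measurableTypeR R).
  by move=> mT A mA; exact: (measurable_funPT (E n) mT A mA).
pose E' : {mfun T >-> measurableTypeR R} :=
  @mfun_Sub _ _ T (measurableTypeR R) (E n) (mem_set mE).
transitivity (\int[distribution P E']_y (f y)%:E)%E.
  by rewrite !ge0_integral_distribution//;
    do ?[exact/measurable_EFinP | by move=> y; rewrite lee_fin].
rewrite (@ge0_integral_density _ _ (measurableTypeR R) f mf f0
  (@lebesgue_measure R) (distribution P E') (exponential_pdf 1))//.
- rewrite [RHS]integral_mkcond; apply: eq_integral => y _.
  rewrite patchE /exponential_pdf patchE; case: ifPn => _; last by rewrite mulr0.
  by rewrite mul1r mulN1r.
- exact: measurable_exponential_pdf.
- by move=> A mA; exact: Elaw.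
Qed.

Definition partial_time (n : nat) (w : T) : R := \sum_(i < n) E i w.

Lemma partial_timeS (n : nat) (w : T) :
  partial_time n.+1 w = partial_time n w + E n w.
Proof. by rewrite /partial_time big_ord_recr. Qed.

Definition arrival_product (h : R -> R) (n : nat) (w : T) : R :=
  \prod_(j < n) h (partial_time j.+1 w).

(** The hypothesis on [v] says that its value at [s] is the mean of [h * v] after
    one more exponential waiting time. Hence
    [arrival_product h n * v (partial_time n)] is a martingale, of which only the
    constancy of the mean is recorded. *)
Lemma arrival_martingale (h v : R -> R) :
  measurable_fun [set: R] h -> (forall x, 0 <= h x) ->
  measurable_fun [set: R] v -> (forall x, 0 <= v x) ->
  (forall s, (\int[mu]_(y in `[0%R, +oo[)
     (h (s + y) * v (s + y) * expR (- y))%:E = (v s)%:E)%E) ->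
  forall n, (\int[P]_w (arrival_product h n w * v (partial_time n w))%:E =
    (v 0)%:E)%E.
Proof.
move=> mh h0 mv v0 hv; elim=> [|n IH].
  under eq_integral do rewrite /arrival_product /partial_time !big_ord0 mul1r.
  by rewrite integral_cst//= probability_setT mule1.
rewrite -IH; pose V w := (arrival_product h n w, partial_time n w).
have Q0 w : 0 <= arrival_product h n w by apply: prodr_ge0.
pose k (q : (R * R) * R) : \bar R :=
  (`|q.1.1| * (h (q.1.2 + q.2) * v (q.1.2 + q.2)))%:E.
have mk : measurable_fun [set: (R * R) * R] k.
  have madd : measurable_fun [set: (R * R) * R] (fun q => q.1.2 + q.2).
    by apply: measurable_funD => //; exact: measurableT_comp.
  apply/measurable_EFinP; apply: measurable_funM.
    by apply: measurableT_comp => //; exact: measurableT_comp.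
  by apply: measurable_funM; exact: measurableT_comp.
have k0 q : (0 <= k q)%E by rewrite lee_fin !mulr_ge0.
pose G := cylinder E (iota 0 n).
have mpart i : (i <= n)%N -> measurable_fun [set: g_sigma_algebraType G]
    (partial_time i : g_sigma_algebraType G -> R).
  move=> ni; apply: measurable_sum => j; apply: cylinder_coordinate.
  by rewrite mem_iota/= add0n (leq_trans (ltn_ord j)).
have mV : measurable_fun [set: g_sigma_algebraType G]
    (V : g_sigma_algebraType G -> R * R).
  apply: measurable_fun_pair; last exact: mpart.
  by apply: measurable_prod => j _; apply: measurableT_comp => //; exact: mpart.
transitivity (\int[P]_w k (V w, E n w))%E.
  apply: eq_integral => w _; rewrite /k/= ger0_norm// -partial_timeS mulrA.
  by rewrite /arrival_product big_ord_recr.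
rewrite (integral_independent Eindep (s := iota 0 n))//; last 2 first.
- exact: iota_uniq.
- by rewrite mem_iota ltnn andbF.
apply: eq_integral => w _; rewrite /k/=.
under eq_integral do rewrite EFinM.
have mhv : measurable_fun [set: R]
    (fun y => h (partial_time n w + y) * v (partial_time n w + y)).
  by apply: measurable_funM; apply: measurableT_comp => //; exact: measurable_funD.
rewrite ge0_integralZl_EFin//; last 2 first.
- by move=> y _; rewrite lee_fin mulr_ge0.
- exact/measurable_EFinP.
rewrite integral_exponential_law//; last by move=> y; rewrite mulr_ge0.
by rewrite hv ger0_norm.
Qed.

End exponential_arrivals.

(** * The Laplace exponent of the limit law *)

Section power_integral.
Context (R : realType).
Let mu := @lebesgue_measure R.

Lemma continuous_powR (k x : R) : 0 < x -> {for x, continuous (fun y : R => y `^ k)}.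
Proof.
move=> x0; apply: differentiable_continuous; apply/derivable1_diffP.
by apply: derivable_powR; rewrite in_itv/= andbT.
Qed.

(** The integrand is singular at [0], so its primitive is used on the intervals
    [[1 / (i + 2), 1]], which exhaust the domain. *)
Lemma le_integral_powR (k : R) : 0 < k < 1 ->
  (\int[mu]_(u in `]0%R, 1%R[) (u `^ (- k))%:E <= ((1 - k)^-1)%:E)%E.
Proof.
move=> /andP[k0 k1]; have k10 : 0 < 1 - k by rewrite subr_gt0.
pose F (i : nat) : set (measurableTypeR R) := `[(i.+2%:R)^-1, 1]%classic.
have F0 i x : F i x -> 0 < x.
  by rewrite /F/= in_itv/= => /andP[+ _]; apply: lt_le_trans; rewrite invr_gt0.
have mpow (D : set (measurableTypeR R)) :
    measurable_fun D (fun u : measurableTypeR R => (u `^ (- k))%:E).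
  by apply: measurable_funTS; apply/measurable_EFinP; exact: measurable_powR.
have FE i : (\int[mu]_(u in F i) (u `^ (- k))%:E <= ((1 - k)^-1)%:E)%E.
  pose G u := (1 - k)^-1 * u `^ (1 - k).
  have i1 : (i.+2%:R)^-1 < 1 :> R by rewrite invf_lt1// ltr1n.
  have dG (x : R) : 0 < x -> is_derive x 1 G (x `^ (- k)).
    move=> x0; have := is_deriveZ (1 - k)^-1 (is_derive1_powR (1 - k) x0).
    by rewrite /GRing.scale/= mulrA mulVf ?gt_eqF// mul1r addrAC subrr add0r.
  have cG (x : R) : 0 < x -> {for x, continuous G}.
    move=> x0; apply: differentiable_continuous; apply/derivable1_diffP.
    by have [] := dG _ x0.
  rewrite (@continuous_FTC2 _ _ G)//.
  - rewrite -EFinB lee_fin /G powR1 mulr1 lerBlDr lerDl mulr_ge0//.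
    by rewrite invr_ge0 ltW.
  - apply: continuous_in_subspaceT => x; rewrite inE => /(F0 i) x0.
    exact: continuous_powR.
  - split.
    + move=> x; rewrite in_itv/= => /andP[ix _].
      have x0 : 0 < x by apply: lt_trans ix; rewrite invr_gt0.
      by have [] := dG _ x0.
    + by apply: cvg_at_right_filter; apply: cG; rewrite invr_gt0.
    + by apply: cvg_at_left_filter; exact: cG.
  - move=> x; rewrite in_itv/= => /andP[ix _].
    have x0 : 0 < x by apply: lt_trans ix; rewrite invr_gt0.
    by rewrite derive1E; have [_ ->] := dG _ x0.
have FU : \bigcup_i F i = `]0, 1]%classic.
  apply/seteqP; split => x /=.
    by move=> [i _ Fx]; rewrite in_itv/= (F0 i)//; move: Fx; rewrite /F/= in_itv/= => /andP[].
  rewrite in_itv/= => /andP[x0 x1].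
  exists (Num.truncn x^-1) => //; rewrite /F/= in_itv/= x1 andbT.
  rewrite invf_ple ?posrE// ltW//; apply: lt_trans (truncnS_gt _) _.
  by rewrite ltr_nat.
apply: (@le_trans _ _ (\int[mu]_(u in \bigcup_i F i) (u `^ (- k))%:E)%E).
  apply: ge0_subset_integral => //.
  - by rewrite FU.
  - by move=> x _; rewrite lee_fin; exact: powR_ge0.
  - by rewrite FU; apply: subset_itvl; rewrite bnd_simp.
have cF : (\int[mu]_(x in F i) (x `^ (- k))%:E)%E @[i --> \oo] -->
    (\int[mu]_(u in \bigcup_i F i) (u `^ (- k))%:E)%E.
  apply: ge0_nondecreasing_set_cvg_integral => //.
  - apply/nondecreasing_seqP => i; rewrite subsetEset; apply: subset_itvr.
    by rewrite bnd_simp lef_pV2 ?posrE// ler_nat.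
  - by move=> i; exact: measurable_itv.
  - by move=> i x _; rewrite lee_fin; exact: powR_ge0.
rewrite -(cvg_lim _ cF)//; apply: lime_le.
  by apply/cvg_ex; eexists; exact: cF.
by apply: nearW => i; exact: FE.
Qed.

End power_integral.

Section levy_exponent.
Context (R : realType).
Let mu := @lebesgue_measure R.

(** The solution [y] of [1 - expR (- (t * y)) = u]. *)
Definition level (t u : R) : R := - ln (1 - u) / t.

(** The integral of [1 - expR (- (t * r `^ (- alpha^-1)))] over [r > 0], that is, the
    exponent of the Laplace transform of the gamma series: the arrival times are
    the points of a Poisson process of unit intensity. It is written as an
    integral over the levels [u] of the integrand, the form in which it also
    comes out of the tail of [X]; [integral_atom_weight] relates the two. *)
Definition levy_exponent (alpha t : R) : \bar R :=
  (\int[mu]_(u in `]0%R, 1%R[) (level t u `^ (- alpha))%:E)%E.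

Lemma le_level (t u : R) : 0 < t -> u < 1 -> u / t <= level t u.
Proof.
move=> t0 u1; rewrite /level ler_pM2r ?invr_gt0// lerNr.
by apply: le_ln1Dx; rewrite ltrNl opprK.
Qed.

Lemma level_gt0 (t u : R) : 0 < t -> 0 < u < 1 -> 0 < level t u.
Proof.
move=> t0 /andP[u0 u1]; apply: lt_le_trans (le_level t0 u1).
by rewrite divr_gt0.
Qed.

Lemma measurable_level (t : R) : measurable_fun [set: R] (level t).
Proof.
apply: measurable_funM => //; apply: measurableT_comp => //.
by apply: measurableT_comp; [exact: measurable_ln|exact: measurable_funB].
Qed.

(** [level t u] is at least [u / t], and [u `^ (- alpha)] is integrable at [0]
    because [alpha < 1]. *)
Lemma levy_exponent_lty (alpha t : R) : 0 < alpha < 1 -> 0 < t ->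
  (levy_exponent alpha t < +oo)%E.
Proof.
move=> a01 t0; have /andP[a0 a1] := a01.
apply: (@le_lt_trans _ _ ((t `^ alpha)%:E *
    \int[mu]_(u in `]0%R, 1%R[) (u `^ (- alpha))%:E)%E); last first.
  apply: lte_mul_pinfty; rewrite ?lee_fin ?powR_ge0//.
  by apply: le_lt_trans (le_integral_powR a01) _; rewrite ltry.
have mp (b : R) : measurable_fun [set: R] (fun u : R => (u `^ b)%:E).
  by apply/measurable_EFinP; exact: measurable_powR.
rewrite -ge0_integralZl_EFin//.
- apply: ge0_le_integral => //.
  + by move=> u _; rewrite lee_fin powR_ge0.
  + apply: measurable_funTS; apply/measurable_EFinP.
    apply: (measurableT_comp (measurable_powR _)).
    exact: measurable_level.
  + by apply: emeasurable_funM => //; apply: measurable_funTS; exact: mp.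
  + move=> u /=; rewrite in_itv/= => /andP[u0 u1]; rewrite -EFinM lee_fin.
    have -> : t `^ alpha * u `^ (- alpha) = (u / t) `^ (- alpha).
      by rewrite powRM ?invr_ge0 ?ltW// -[t^-1]powR_inv1 ?ltW// -powRrM mulrNN mul1r mulrC.
    have l0 : 0 < level t u by rewrite level_gt0// u0.
    have ut0 : 0 < u / t by rewrite divr_gt0.
    rewrite !powRN lef_pV2 ?posrE; [|exact: powR_gt0|exact: powR_gt0].
    apply: ge0_ler_powR; rewrite ?nnegrE; [exact: ltW|exact/ltW|exact: ltW|].
    exact: le_level.
- by move=> u _; rewrite lee_fin powR_ge0.
- by apply: measurable_funTS; exact: mp.
- exact: powR_ge0.
Qed.

Lemma levy_exponent_ge0 (alpha t : R) : (0 <= levy_exponent alpha t)%E.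
Proof. by apply: integral_ge0 => u _; rewrite lee_fin powR_ge0. Qed.

Lemma levy_exponent_fin_num (alpha t : R) : 0 < alpha < 1 -> 0 < t ->
  levy_exponent alpha t \is a fin_num.
Proof. by move=> a01 t0; rewrite ge0_fin_numE ?levy_exponent_ge0 ?levy_exponent_lty. Qed.

(** The limit law is strictly stable: its exponent is homogeneous. *)
Lemma levy_exponent_scale (alpha t : R) : 0 < t ->
  levy_exponent alpha t = ((t `^ alpha)%:E * levy_exponent alpha 1)%E.
Proof.
move=> t0; rewrite /levy_exponent -ge0_integralZl_EFin//.
- apply: eq_integral => u; rewrite inE/= in_itv/= => u01.
  rewrite -EFinM; congr EFin; rewrite {1}/level powRM ?invr_ge0 ?ltW//; last first.
    by have := level_gt0 ltr01 u01; rewrite /level divr1.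
  rewrite /level divr1 mulrC; congr (_ * _).
  by rewrite -[t^-1]powR_inv1 ?ltW// -powRrM mulrNN mul1r.
- by move=> u _; rewrite lee_fin powR_ge0.
- apply: measurable_funTS; apply/measurable_EFinP.
  by apply: (measurableT_comp (measurable_powR _)); exact: measurable_level.
- exact: powR_ge0.
Qed.

(** Laplace weight of an atom: [exp (- t x)] at [x = r ^ (-1 / alpha)], the
    point of the limiting Poisson process with arrival time [r]. Extending it by
    [0] makes it continuous on the whole line. *)
Definition atom_weight (alpha t r : R) : R :=
  if 0 < r then expR (- (t * r `^ (- alpha^-1))) else 0.

Lemma atom_weight_ge0 (alpha t r : R) : 0 <= atom_weight alpha t r.
Proof. by rewrite /atom_weight; case: ifP => // _; rewrite expR_ge0. Qed.

Lemma atom_weight_le1 (alpha t r : R) : 0 < t -> atom_weight alpha t r <= 1.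
Proof.
move=> t0; rewrite /atom_weight; case: ifP => // _.
by rewrite expR_le1 oppr_le0 mulr_ge0 ?powR_ge0 ?ltW.
Qed.

Lemma atom_weight_superlevel (alpha t u : R) : 0 < alpha -> 0 < t -> 0 < u < 1 ->
  [set r | 0 < r /\ u < 1 - atom_weight alpha t r] =
  `]0, level t u `^ (- alpha)[%classic.
Proof.
move=> a0 t0 u01; have q0 := level_gt0 t0 u01; have /andP[u0 u1] := u01.
apply/seteqP; split => r /=; rewrite in_itv/=.
  move=> [r0]; rewrite /atom_weight r0 ltrBrDr -ltrBrDl/= => h.
  rewrite -ltr_ln ?posrE ?powR_gt0// ln_powR.
  have : level t u < r `^ (- alpha^-1).
    rewrite /level ltr_pdivrMr// mulrC ltrNl -ltr_expR lnK// posrE subr_gt0//.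
  rewrite -ltr_ln ?posrE ?powR_gt0// ln_powR => h2.
  have := ltr_pM2l a0 (ln (level t u)) (- alpha^-1 * ln r); rewrite h2.
  by rewrite mulrA mulrN divff ?gt_eqF// mulN1r mulNr ltrNr.
move=> /andP[r0 h]; split => //; rewrite /atom_weight r0 ltrBrDr -ltrBrDl.
have h2 : level t u < r `^ (- alpha^-1).
  have hln : ln r < - alpha * ln (level t u).
    by rewrite -ln_powR ltr_ln ?posrE ?powR_gt0.
  rewrite -ltr_ln ?posrE ?powR_gt0// ln_powR.
  rewrite -(ltr_pM2l a0) mulrA mulrN divff ?gt_eqF// mulN1r.
  by rewrite ltrNr -mulNr.
move: h2; rewrite /level ltr_pdivrMr// mulrC ltrNl -ltr_expR lnK// posrE subr_gt0//.
Qed.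

Lemma continuous_atom_weight (alpha t : R) : 0 < alpha < 1 -> 0 < t ->
  continuous (atom_weight alpha t).
Proof.
move=> /andP[a0 a1] t0 x; have [x0|x0|->] := ltgtP x 0.
- have : {near x, cst 0 =1 atom_weight alpha t}.
    near=> y; rewrite /atom_weight ifN// -leNgt ltW//; near: y.
    exact: lt_nbhsl.
  move=> h; apply: cvg_trans; first exact: (near_eq_cvg h).
  by rewrite /atom_weight ltNge ltW//=; exact: cvg_cst.
- have : {near x, (fun r => expR (- (t * r `^ (- alpha^-1)))) =1 atom_weight alpha t}.
    near=> y; rewrite /atom_weight ifT//; near: y.
    exact: lt_nbhsr.
  move=> h; apply: cvg_trans; first exact: (near_eq_cvg h).
  rewrite /atom_weight x0; apply: cvg_comp; last exact: continuous_expR.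
  by apply: cvgN; apply: cvgM; [exact: cvg_cst|exact: continuous_powR].
- rewrite /continuous_at (_ : atom_weight alpha t 0 = 0); last by rewrite /atom_weight ltxx.
  apply/cvgrPdist_le => e e0; near=> y.
  rewrite sub0r normrN /atom_weight; case: ifPn => y0; last by rewrite normr0 ltW.
  rewrite ger0_norm ?expR_ge0//.
  have y1 : y < 1 by near: y; apply: lt_nbhsl.
  have yte : y < t * e by near: y; apply: lt_nbhsl; rewrite mulr_gt0.
  have yp : y^-1 <= y `^ (- alpha^-1).
    rewrite powRN lef_pV2 ?posrE ?powR_gt0//.
    by apply: ge1r_powR; rewrite ?y0 ?(ltW y1)//= invf_ge1 ?ltW.
  rewrite expRN -[e]invrK lef_pV2 ?posrE ?expR_gt0 ?invr_gt0//.
  apply: le_trans (expR_ge1Dx _); apply: (@le_trans _ _ (t * y^-1)); last first.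
    by rewrite (le_trans (ler_wpM2l (ltW t0) yp))// lerDr.
  by rewrite ler_pdivlMr// mulrC ler_pdivrMr// ltW.
Unshelve. all: by end_near. Qed.

Lemma measurable_atom_weight (alpha t : R) : 0 < alpha < 1 -> 0 < t ->
  measurable_fun [set: R] (atom_weight alpha t).
Proof.
by move=> a01 t0; apply: continuous_measurable_fun; exact: continuous_atom_weight.
Qed.

(** Layer cake: the superlevel set of [1 - atom_weight] at [u] is an interval of
    length [level t u `^ (- alpha)]. *)
Lemma integral_atom_weight (alpha t : R) : 0 < alpha < 1 -> 0 < t ->
  (\int[mu]_(r in `[0%R, +oo[) (1 - atom_weight alpha t r)%:E =
   levy_exponent alpha t)%E.
Proof.
move=> a01 t0; have /andP[a0 a1] := a01.
pose f (r : measurableTypeR R) : R := if 0 < r then 1 - atom_weight alpha t r else 0.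
have f0 r : 0 <= f r.
  by rewrite /f; case: ifP => // _; rewrite subr_ge0 atom_weight_le1.
have mf : measurable_fun [set: measurableTypeR R] f.
  apply: measurable_fun_ifT => //.
    exact: measurable_fun_ltr.
  by apply: measurable_funB => //; exact: measurable_atom_weight.
transitivity (\int[mu]_r (f r)%:E)%E.
  rewrite -integral_itv_obnd_cbnd; last first.
    apply/measurable_EFinP; apply: measurable_funTS; apply: measurable_funB => //.
    exact: measurable_atom_weight.
  rewrite integral_mkcond; apply: eq_integral => r _; rewrite patchE /f.
  case: ifPn; rewrite ?inE ?notin_setE/= in_itv/= andbT; first by move=> ->.
  by move=> /negP/negbTE ->.
rewrite (layer_cake mf f0 (@lebesgue_measure R)).
rewrite integral_mkcond [RHS]integral_mkcond; apply: eq_integral => u _.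
rewrite !patchE; case: ifPn; rewrite ?inE ?notin_setE/= in_itv/= ?andbT => u0; last first.
  rewrite memNset//= in_itv/= => /andP[/negP]; exact.
case: ifPn; rewrite ?inE ?notin_setE/= in_itv/= u0/= => u1.
  have u01 : 0 < u < 1 by rewrite u0.
  rewrite (_ : [set x | u < f x] = `]0, level t u `^ (- alpha)[%classic).
    rewrite lebesgue_measure_itv/= lte_fin powR_gt0 ?level_gt0//.
    by rewrite sube0.
  rewrite -atom_weight_superlevel//; apply/seteqP; split => r /=; rewrite /f.
    by case: ifP => // _; rewrite ltNge ltW.
  by move=> [-> ].
rewrite (_ : [set x | u < f x] = set0) ?measure0//.
apply/seteqP; split => r //=; rewrite /f; apply/negP; rewrite -leNgt.
case: ifP => r0; last by rewrite ltW.
apply: (@le_trans _ _ 1); last by rewrite leNgt; exact/negP.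
by rewrite lerBlDr lerDl atom_weight_ge0.
Qed.

End levy_exponent.

(** * The compensator of the arrival process *)

Section compensator.
Context (R : realType) (alpha t : R).
Hypotheses (a01 : 0 < alpha < 1) (t0 : 0 < t).
Let mu := @lebesgue_measure R.
Let w := atom_weight alpha t.
Let c := fine (levy_exponent alpha t).

Let w0 r : 0 <= w r. Proof. exact: atom_weight_ge0. Qed.
Let w1 r : w r <= 1. Proof. exact: atom_weight_le1. Qed.
Let cw : continuous w. Proof. exact: continuous_atom_weight. Qed.
Let mw (D : set R) : measurable_fun D w.
Proof. by apply: measurable_funTS; exact: measurable_atom_weight. Qed.

Lemma integrable_atom_weight (u : R) :
  mu.-integrable `]-oo, u] (EFin \o w).
Proof.
apply/integrableP; split; first by apply/measurable_EFinP; exact: mw.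
apply: (@le_lt_trans _ _ (\int[mu]_(r in `]-oo, u])
    (\1_(`[0, u]%classic : set R) r)%:E)%E).
  apply: ge0_le_integral => //.
  - do 2 apply: measurableT_comp => //; exact: mw.
  - by apply: measurable_funTS; apply/measurable_EFinP; exact: measurable_indic.
  - move=> r /=; rewrite in_itv/= => ru; rewrite lee_fin ger0_norm//.
    rewrite indicE; case: (ltP 0 r) => r0.
      by rewrite mem_set//= in_itv/= ltW.
    by rewrite /w /atom_weight ltNge r0.
rewrite integral_indic//= setIidl; last by apply: subset_itvr.
by rewrite /mu lebesgue_measure_itv/=; case: ifPn => _; rewrite ?ltry// -EFinB ltry.
Qed.

(** It equals the integral of [1 - w] from [0] to [s] for [0 <= s], and [s] for
    [s <= 0]; integrating [w] from [-oo] covers both cases by one formula,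
    differentiable on the whole line. *)
Definition compensator (s : R) : R := s - \int[mu]_(r in `]-oo, s]) w r.

Lemma is_derive_compensator (s : R) : is_derive s 1 compensator (1 - w s).
Proof.
have s1 : s < s + 1 by rewrite ltrDl.
have [dF F'] := continuous_FTC1 s1 (integrable_atom_weight (s + 1)) (ltNyr _) (@cw s).
have dF' : is_derive s 1 (fun x => \int[mu]_(r in `]-oo, x]) w r) (w s).
  by split => //; rewrite -derive1E.
exact: is_deriveB.
Qed.

Lemma continuous_compensator : continuous compensator.
Proof.
move=> s; apply: differentiable_continuous; apply/derivable1_diffP.
by have [] := is_derive_compensator s.
Qed.

Lemma compensator0 : compensator 0 = 0.
Proof.
rewrite /compensator /Rintegral integral0_eq ?subr0// => r /=.
by rewrite in_itv/= /w /atom_weight leNgt => /negbTE ->.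
Qed.

Lemma compensator_ndecr : nondecreasing_fun compensator.
Proof.
move=> x y xy; apply: (@ger0_derive1_ndecr _ compensator x y) => //.
- by move=> z _; have [] := is_derive_compensator z.
- move=> z _; rewrite derive1E; have [_ ->] := is_derive_compensator z.
  by rewrite subr_ge0.
- by apply: continuous_subspaceT; exact: continuous_compensator.
Qed.

Lemma integral_compensator (s : R) : 0 < s ->
  (\int[mu]_(r in `[0%R, s]) (1 - w r)%:E = (compensator s)%:E)%E.
Proof.
move=> s0; rewrite (@continuous_FTC2 _ _ compensator)//.
- by rewrite compensator0 sube0.
- by apply: continuous_subspaceT => r; apply: cvgB; [exact: cvg_cst|exact: cw].
- split.
  + by move=> x _; have [] := is_derive_compensator x.
  + by apply: cvg_at_right_filter; exact: continuous_compensator.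
  + by apply: cvg_at_left_filter; exact: continuous_compensator.
- by move=> x _; rewrite derive1E; have [] := is_derive_compensator x.
Qed.

Lemma compensator_le (s : R) : compensator s <= c.
Proof.
have [s0|s0] := leP s 0.
  apply: (le_trans (compensator_ndecr s0)); rewrite compensator0.
  by rewrite fine_ge0// levy_exponent_ge0.
rewrite -lee_fin -integral_compensator// fineK ?levy_exponent_fin_num//.
rewrite -integral_atom_weight//; apply: ge0_subset_integral => //.
- apply/measurable_EFinP; apply: measurable_funB => //; exact: mw.
- by move=> r _; rewrite lee_fin subr_ge0.
- exact: subset_itvl.
Qed.

Lemma compensator_cvg : compensator s @[s --> +oo] --> c.
Proof.
have cvgK : compensator s @[s --> +oo] --> sup (range compensator).
  apply: nondecreasing_cvgr; first exact: compensator_ndecr.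
  by exists c => _ [s _ <-]; exact: compensator_le.
suff -> : c = sup (range compensator) by [].
rewrite /c -integral_atom_weight//.
rewrite (ge0_continuous_FTC2y (F := compensator) _ _ cvgK)//.
- by rewrite compensator0 sube0.
- by move=> r _; rewrite subr_ge0.
- by apply: continuous_subspaceT => r; apply: cvgB; [exact: cvg_cst|exact: cw].
- by move=> x _; have [] := is_derive_compensator x.
- by apply: cvg_at_right_filter; exact: continuous_compensator.
- by move=> x _; rewrite derive1E; have [] := is_derive_compensator x.
Qed.

(** Since the derivative of [compensator] is [1 - w], the exponential of the
    compensator is harmonic for the arrival dynamics weighted by [w]. *)
Lemma integral_exp_compensator (s : R) :
  (\int[mu]_(y in `[0%R, +oo[)
     (w (s + y) * expR (compensator (s + y)) * expR (- y))%:E =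
   (expR (compensator s))%:E)%E.
Proof.
pose F y := - expR (compensator (s + y) - y).
have dF (y : R) : is_derive y 1 F
    (w (s + y) * expR (compensator (s + y)) * expR (- y)).
  have d1 : is_derive y 1 (fun y => s + y) (1 : R).
    by have := is_deriveD (is_derive_cst s y 1) (is_derive_id y 1); rewrite add0r.
  have d2 : is_derive y 1 (fun y => compensator (s + y)) (1 - w (s + y)).
    have := is_derive1_comp (f := compensator) (g := fun y => s + y)
      (is_derive_compensator (s + y)) d1.
    by rewrite mulr1.
  have d3 : is_derive y 1 (fun y => compensator (s + y) - y) (- w (s + y)).
    have := is_deriveB d2 (is_derive_id y 1).
    by rewrite (_ : 1 - w (s + y) - 1 = - w (s + y)); last by rewrite addrAC subrr add0r.
  have := is_deriveN (is_derive1_comp (f := expR) (is_derive_expR _) d3).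
  by rewrite mulrN opprK expRD mulrC mulrA.
have cF : continuous F.
  by move=> y; apply: differentiable_continuous; apply/derivable1_diffP;
    have [] := dF y.
have Fy : F y @[y --> +oo] --> 0.
  apply: (squeeze_cvgr (f := fun y => - (expR c * expR (- y))) (h := cst 0)).
  + near=> y; rewrite /F oppr_le0 expR_ge0 andbT lerN2 -expRD ler_expR lerD2r.
    exact: compensator_le.
  + by rewrite -oppr0 -(mulr0 (expR c)); apply: cvgN; exact: (cvgM (cvg_cst _) (@cvgr_expR R)).
  + exact: cvg_cst.
rewrite (ge0_continuous_FTC2y (F := F) (l := 0))//.
- by rewrite /F addr0 subr0 sub0e EFinN oppeK.
- by move=> y _; rewrite !mulr_ge0 ?expR_ge0.
- apply: continuous_subspaceT => y; apply: cvgM.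
    apply: cvgM.
      by apply: cvg_comp; [|exact: cw]; apply: cvgD; [exact: cvg_cst|].
    apply: cvg_comp; last exact: continuous_expR.
    by apply: cvg_comp; [|exact: continuous_compensator]; apply: cvgD; [exact: cvg_cst|].
  by apply: cvg_comp; [|exact: continuous_expR]; apply: cvgN.
- by apply: cvg_at_right_filter; exact: cF.
- by move=> y _; rewrite derive1E; have [] := dF y.
Unshelve. all: by end_near. Qed.

End compensator.

(** * Laplace transform of the gamma series *)

Section gamma_series_laplace.
Context (R : realType) (d : measure_display) (T : measurableType d)
  (P : probability T R) (E : nat -> {RV P >-> R}) (alpha : R).
Hypothesis a01 : 0 < alpha < 1.
Hypothesis Elaw : forall (j : nat) (A : set R), measurable A ->
  distribution P (E j) A = exponential_prob 1 A.
Hypothesis Eindep : mutually_independent [set: nat] E.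

Let mu := @lebesgue_measure R.

Lemma measurable_partial_time (n : nat) :
  measurable_fun [set: T] (partial_time E n).
Proof. exact: measurable_sum. Qed.

(** The function [expR (- s)] is harmonic in the sense of [arrival_martingale] for
    the constant weight [2]. This makes the divergence of the arrival times
    quantitative. *)
Lemma integral_exp_partial_time (n : nat) :
  (\int[P]_w (expR (- partial_time E n w))%:E = ((2 ^+ n)^-1)%:E)%E.
Proof.
have h (s : R) : (\int[mu]_(y in `[0%R, +oo[)
    (cst 2 (s + y) * expR (- (s + y)) * expR (- y))%:E = (expR (- s))%:E)%E.
  pose F y := - expR (- s - 2 * y).
  have dF (y : R) : is_derive y 1 F (cst 2 (s + y) * expR (- (s + y)) * expR (- y)).
    have d1 : is_derive y 1 (fun y => - s - 2 * y) (- 2 : R).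
      have := is_deriveB (is_derive_cst (- s) y 1)
        (is_deriveZ 2 (is_derive_id y 1)).
      by rewrite add0r /GRing.scale/= mulr1.
    have := is_deriveN (is_derive1_comp (f := expR) (is_derive_expR _) d1).
    rewrite /cst/= -mulrA -expRD mulrN opprK mulrC.
    by rewrite (_ : - (s + y) - y = - s - 2 * y); last by lra.
  have cF : continuous F.
    by move=> y; apply: differentiable_continuous; apply/derivable1_diffP.
  have Fy : F y @[y --> +oo] --> 0.
    apply: (squeeze_cvgr (f := fun y => - (expR (- s) * expR (- y))) (h := cst 0)).
    + near=> y; rewrite /F oppr_le0 expR_ge0 andbT lerN2 -expRD ler_expR.
      have : 0 <= y by near: y; apply: nbhs_pinfty_ge; rewrite num_real.
      lra.
    + by rewrite -oppr0 -(mulr0 (expR (- s))); apply: cvgN;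
        exact: (cvgM (cvg_cst _) (@cvgr_expR R)).
    + exact: cvg_cst.
  rewrite (ge0_continuous_FTC2y (F := F) (l := 0))//.
  - by rewrite /F mulr0 subr0 sub0e EFinN oppeK.
  - by move=> y _; rewrite !mulr_ge0 ?expR_ge0.
  - apply: continuous_subspaceT => y; apply: cvgM; last first.
      by apply: cvg_comp; [|exact: continuous_expR]; apply: cvgN.
    apply: cvgM; first exact: cvg_cst.
    apply: cvg_comp; [|exact: continuous_expR].
    by apply: cvgN; apply: cvgD; [exact: cvg_cst|].
  - by apply: cvg_at_right_filter; exact: cF.
  - by move=> y _; rewrite derive1E; have [] := dF y.
have mexp : measurable_fun [set: R] (fun x : R => expR (- x)).
  by apply: measurableT_comp => //; exact: measurable_funN.
have := arrival_martingale Elaw Eindep (h := cst 2) (v := fun x => expR (- x)) _ _ _ _ h n.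
rewrite /= oppr0 expR0 => H.
have p2 : 0 < (2 ^+ n : R) by rewrite exprn_gt0.
have -> : (\int[P]_w (expR (- partial_time E n w))%:E =
   ((2 ^+ n)^-1)%:E * \int[P]_w (arrival_product E (cst 2) n w *
      expR (- partial_time E n w))%:E)%E.
  rewrite -ge0_integralZl_EFin//.
  - apply: eq_integral => w _; rewrite -EFinM; congr EFin.
    by rewrite /arrival_product big_const_ord iter_mulr_1 mulKf// gt_eqF.
  - by move=> w _; rewrite lee_fin mulr_ge0 ?expR_ge0//; apply: prodr_ge0.
  - apply/measurable_EFinP; apply: measurable_funM.
      by apply: measurable_prod.
    by apply: (measurableT_comp mexp); exact: measurable_partial_time.
by rewrite H ?mule1//; move=> x; exact: expR_ge0.
Unshelve. all: by end_near. Qed.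

Section fixed_parameter.
Variable t : R.
Hypothesis t0 : 0 < t.
Let w := atom_weight alpha t.
Let c := fine (levy_exponent alpha t).
Let K := compensator alpha t.
Let Q := arrival_product E w.

Lemma measurable_arrival_product (n : nat) : measurable_fun [set: T] (Q n).
Proof.
apply: measurable_prod => j _; apply: measurableT_comp.
  exact: measurable_atom_weight.
exact: measurable_partial_time.
Qed.

Lemma arrival_product_ge0 (n : nat) (x : T) : 0 <= Q n x.
Proof. by apply: prodr_ge0 => j _; exact: atom_weight_ge0. Qed.

Lemma arrival_product_le1 (n : nat) (x : T) : Q n x <= 1.
Proof.
by apply: prodr_ile1 => j _; rewrite atom_weight_ge0 atom_weight_le1.
Qed.

Lemma measurable_compensator : measurable_fun [set: R] K.
Proof. by apply: continuous_measurable_fun; exact: continuous_compensator. Qed.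

Lemma integral_arrival_product_compensated (n : nat) :
  (\int[P]_x (Q n x * expR (K (partial_time E n x)))%:E = 1)%E.
Proof.
rewrite (arrival_martingale Elaw Eindep (h := w) (v := expR \o K))//=.
- by rewrite /K compensator0 expR0.
- exact: measurable_atom_weight.
- by move=> x; exact: atom_weight_ge0.
- by apply: measurableT_comp => //; exact: measurable_compensator.
- exact: integral_exp_compensator.
Qed.

(** The compensated product has expectation one and the compensator tends to [c]
    along the arrival times, which diverge; hence the limit. *)
Lemma cvg_integral_arrival_product :
  (\int[P]_x (Q n x)%:E)%E @[n --> \oo] --> (expR (- c))%:E.
Proof.
have mQ n : measurable_fun [set: T] (fun x => (Q n x)%:E).
  by apply/measurable_EFinP; exact: measurable_arrival_product.
have mQK n : measurable_fun [set: T]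
    (fun x => (Q n x * expR (K (partial_time E n x)))%:E).
  apply/measurable_EFinP; apply: measurable_funM.
    exact: measurable_arrival_product.
  apply: measurableT_comp => //; apply: measurableT_comp.
    exact: measurable_compensator.
  exact: measurable_partial_time.
have Qfin n : (\int[P]_x (Q n x)%:E)%E \is a fin_num.
  rewrite ge0_fin_numE; last first.
    by apply: integral_ge0 => x _; rewrite lee_fin arrival_product_ge0.
  apply: (@le_lt_trans _ _ (\int[P]_x 1)%E); last first.
    by rewrite integral_cst// mul1e; apply: le_lt_trans (probability_le1 _ _) _; rewrite ?ltry.
  apply: ge0_le_integral => //.
  - by move=> x _; rewrite lee_fin arrival_product_ge0.
  - by move=> x _; rewrite lee_fin arrival_product_le1.
pose q n := fine (\int[P]_x (Q n x)%:E)%E.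
have lb n : expR (- c) <= q n.
  suff : (1 <= (expR c)%:E * \int[P]_x (Q n x)%:E)%E.
    rewrite -(fineK (Qfin n)) -/(q n) -EFinM lee_fin expRN => h.
    by rewrite -div1r ler_pdivrMr ?expR_gt0// mulrC.
  rewrite -ge0_integralZl_EFin//; last by move=> x _; rewrite lee_fin arrival_product_ge0.
  rewrite -(integral_arrival_product_compensated n).
  apply: ge0_le_integral => //.
  - by move=> x _; rewrite lee_fin mulr_ge0 ?expR_ge0 ?arrival_product_ge0.
  - by apply: emeasurable_funM.
  - move=> x _; rewrite -EFinM lee_fin mulrC ler_wpM2r ?arrival_product_ge0//.
    by rewrite ler_expR compensator_le.
(* Where the arrival time is at most [A], the bound [1 <= expR (A - s)] is used
   and its mean decays geometrically; beyond [A], the compensator is within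
   [c - K A] of its limit. *)
have ub A n : q n <= expR (- c) * (1 + (expR c - expR (K A)) +
    expR (c + A) * (2 ^+ n)^-1).
  suff : ((expR c)%:E * \int[P]_x (Q n x)%:E <=
    (1 + (expR c - expR (K A)) + expR (c + A) * (2 ^+ n)^-1)%:E)%E.
    rewrite -(fineK (Qfin n)) -/(q n) -EFinM lee_fin expRN => h.
    by rewrite mulrC ler_pdivlMr ?expR_gt0// mulrC.
  have gA : 0 <= expR c - expR (K A) by rewrite subr_ge0 ler_expR compensator_le.
  have mexp : measurable_fun [set: T] (fun x => (expR (- partial_time E n x))%:E).
    apply/measurable_EFinP; apply: measurableT_comp => //.
    by apply: measurable_funN; exact: measurable_partial_time.
  rewrite -ge0_integralZl_EFin//; last by move=> x _; rewrite lee_fin arrival_product_ge0.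
  apply: (@le_trans _ _ (\int[P]_x ((Q n x * expR (K (partial_time E n x)))%:E +
    (expR c - expR (K A))%:E + (expR (c + A))%:E * (expR (- partial_time E n x))%:E))%E).
    apply: ge0_le_integral => //.
    - by move=> x _; rewrite mule_ge0// lee_fin ?expR_ge0 ?arrival_product_ge0.
    - exact: emeasurable_funM.
    - by apply: emeasurable_funD; [exact: emeasurable_funD|exact: emeasurable_funM].
    - move=> x _; rewrite -!EFinM -!EFinD lee_fin.
      have Q0 := arrival_product_ge0 n x; have Q1 := arrival_product_le1 n x.
      have Kc := compensator_le a01 t0 (partial_time E n x); rewrite -/K in Kc.
      have [sA|sA] := leP (partial_time E n x) A.
        have h1 : 1 <= expR A * expR (- partial_time E n x).
          by rewrite -expRD -[leLHS]expR0 ler_expR subr_ge0.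
        rewrite (expRD c A) -mulrA.
        apply: (@le_trans _ _ (expR c * (expR A * expR (- partial_time E n x)))).
          by rewrite ler_wpM2l ?expR_ge0// (le_trans Q1).
        by rewrite lerDr addr_ge0// mulr_ge0 ?expR_ge0.
      have KA : K A <= K (partial_time E n x) by apply: compensator_ndecr => //; exact: ltW.
      apply: (@le_trans _ _ (Q n x * expR (K (partial_time E n x)) + (expR c - expR (K A)))).
        rewrite -lerBlDl mulrC -mulrBr.
        apply: (@le_trans _ _ (1 * (expR c - expR (K (partial_time E n x))))).
          by rewrite ler_wpM2r// subr_ge0 ler_expR.
        by rewrite mul1r lerD2l lerN2 ler_expR.
      by rewrite lerDl mulr_ge0 ?expR_ge0.
  rewrite ge0_integralD//; last 3 first.
  - by move=> x _; rewrite adde_ge0// lee_fin// mulr_ge0 ?expR_ge0 ?arrival_product_ge0.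
  - exact: emeasurable_funD.
  - exact: emeasurable_funM.
  rewrite ge0_integralD//; last first.
    by move=> x _; rewrite lee_fin mulr_ge0 ?expR_ge0 ?arrival_product_ge0.
  rewrite integral_arrival_product_compensated integral_cst//= probability_setT mule1.
  rewrite ge0_integralZl_EFin//.
  by rewrite integral_exp_partial_time -EFinM -!EFinD lexx.
apply: cvg_EFin; first exact: nearW.
apply/cvgrPdist_le => e e0.
have Kc : expR (K A) @[A --> +oo] --> expR c.
  by apply: cvg_comp; [exact: compensator_cvg|exact: continuous_expR].
have ec : 0 < expR c * (e / 2) by rewrite !mulr_gt0 ?expR_gt0.
have [A HA] : exists A, expR c - expR (K A) <= expR c * (e / 2).
  move/cvgrPdist_le : Kc => /(_ _ ec) [A [_ HA]].
  exists (A + 1); apply: le_trans (ler_norm _) _; apply: HA.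
  by rewrite ltrDl.
have c2 : expR (c + A) * (2 ^+ n)^-1 @[n --> \oo] --> (0 : R).
  rewrite -(mulr0 (expR (c + A))); apply: cvgM; first exact: cvg_cst.
  under eq_fun do rewrite -exprVn.
  by apply: cvg_expr; rewrite ger0_norm ?invr_ge0// invf_lt1// ltr1n.
move/cvgrPdist_le : c2 => /(_ _ ec); apply: filterS => n.
rewrite sub0r normrN => /(le_trans (ler_norm _)) h.
rewrite ler0_norm /= -/(q n) ?subr_le0// opprB lerBlDr; apply: (le_trans (ub A n)).
rewrite -addrA mulrDr mulr1 [leRHS]addrC lerD2l expRN.
rewrite mulrC ler_pdivrMr ?expR_gt0//; apply: (le_trans (lerD HA h)).
by rewrite -mulrDr -splitr mulrC.
Qed.

(** The value [0] where the series diverges makes this the limit of the arrival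
    products almost everywhere, and lets its mean detect the finiteness of the
    series. *)
Definition laplace_weight (x : T) : R :=
  if (gamma_series alpha E x < +oo)%E
  then expR (- (t * fine (gamma_series alpha E x))) else 0.

Lemma measurable_gamma_series :
  measurable_fun [set: T] (gamma_series alpha E).
Proof.
apply: ge0_emeasurable_sum => [k x _ _|k _]; first by rewrite lee_fin powR_ge0.
apply/measurable_EFinP; apply: (measurableT_comp (measurable_powR _)).
exact: measurable_sum.
Qed.

Lemma measurable_laplace_weight : measurable_fun [set: T] laplace_weight.
Proof.
apply: measurable_fun_ifT => //.
  by apply: measurable_fun_lte => //; exact: measurable_gamma_series.
apply: measurableT_comp => //; apply: measurable_funN; apply: measurable_funM => //.
by apply: measurableT_comp => //; exact: measurable_gamma_series.
Qed.

Lemma ae_waiting_times_gt0 : {ae P, forall x, forall i, 0 < E i x}.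
Proof.
suff : P.-negligible (\bigcup_i [set x | E i x <= 0]).
  apply: negligibleS => x /= /existsNP[i hi]; exists i => //=.
  by rewrite leNgt; exact/negP.
apply: negligible_bigcup => i.
have mi : measurable (`]-oo, 0]%classic : set R) by [].
exists (E i @^-1` `]-oo, 0]); split => //.
- by rewrite -[X in measurable X]setTI; exact: measurable_funPT.
- have := Elaw i mi; rewrite /distribution/= /pushforward/= => ->.
  rewrite /exponential_prob -integral_itv_bndo_bndc; last first.
    by apply: measurable_funTS; apply/measurable_EFinP; exact: measurable_exponential_pdf.
  by apply: integral0_eq => x /=; rewrite in_itv/= => x0; rewrite lt0_exponential_pdf.
Qed.

Lemma cvg_arrival_product (x : T) : (forall i, 0 < E i x) ->
  Q n x @[n --> \oo] --> laplace_weight x.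
Proof.
move=> E0; pose S n := \sum_(0 <= j < n) arrival_time E j x `^ (- alpha^-1).
have pos j : 0 < arrival_time E j x.
  rewrite /arrival_time big_ord_recl ltr_pwDl//; apply: sumr_ge0 => i _; exact: ltW.
have QE n : Q n x = expR (- (t * S n)).
  rewrite /S big_mkord mulr_sumr -sumrN expR_sum; apply: eq_bigr => j _.
  rewrite /w /atom_weight ifT//; exact: pos.
have Scvg : (S n)%:E @[n --> \oo] --> gamma_series alpha E x.
  rewrite (_ : (fun n => (S n)%:E) = fun n =>
      (\sum_(0 <= j < n) (arrival_time E j x `^ (- alpha^-1))%:E)%E); last first.
    by apply/funext => n; rewrite /S sumEFin.
  by apply/cvg_closeP; split; [apply: is_cvg_nneseries => j _ _;
    rewrite lee_fin powR_ge0|rewrite closeE].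
rewrite (_ : Q ^~ x = fun n => expR (- (t * S n))); last exact/funext.
rewrite /laplace_weight; case: ifPn => [fin|].
  apply: cvg_comp; last exact: continuous_expR.
  apply: cvgN; apply: cvgM; first exact: cvg_cst.
  have g0 : (0 <= gamma_series alpha E x)%E.
    by apply: nneseries_ge0 => j _ _; rewrite lee_fin powR_ge0.
  have Sg : (S n)%:E @[n --> \oo] --> (fine (gamma_series alpha E x))%:E.
    by rewrite fineK// ge0_fin_numE.
  exact: (fine_cvg Sg).
rewrite -leNgt leye_eq => /eqP Sy.
rewrite Sy in Scvg.
have Sr : S n @[n --> \oo] --> +oo by apply/cvgeryP.
have tSr : t * S n @[n --> \oo] --> +oo.
  exact: (cvg_comp _ _ Sr (gt0_cvgMry t0 cvg_id)).
exact: (cvg_comp _ _ tSr (@cvgr_expR R)).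
Qed.

Lemma integral_laplace_weight :
  (\int[P]_x (laplace_weight x)%:E = (expR (- c))%:E)%E.
Proof.
have mQ n : measurable_fun [set: T] (fun x => (Q n x)%:E).
  by apply/measurable_EFinP; exact: measurable_arrival_product.
have [||||_ _ h] := @dominated_convergence _ _ _ P [set: T] measurableT
  (fun n x => (Q n x)%:E) (fun x => (laplace_weight x)%:E) (cst 1%E) mQ.
- by apply/measurable_EFinP; exact: measurable_laplace_weight.
- apply: filterS ae_waiting_times_gt0 => x Ex _.
  by apply: cvg_EFin; [exact: nearW|exact: cvg_arrival_product].
- exact: finite_measure_integrable_cst.
- apply: aeW => x n _ /=; rewrite ger0_norm ?arrival_product_ge0//.
  by rewrite lee_fin arrival_product_le1.
- by rewrite -(cvg_lim _ h)//; apply: cvg_lim => //; exact: cvg_integral_arrival_product.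
Qed.

End fixed_parameter.

(** Letting the Laplace parameter tend to [0] in [integral_laplace_weight]
    recovers the probability that the series converges. *)
Lemma ae_gamma_series_lty : {ae P, forall x, (gamma_series alpha E x < +oo)%E}.
Proof.
pose F := [set x | (gamma_series alpha E x < +oo)%E].
have mF : measurable F.
  rewrite /F -[X in measurable X]setTI; apply: emeasurable_fun_infty_o => //.
  exact: measurable_gamma_series.
pose c1 := fine (levy_exponent alpha 1).
have c10 : 0 <= c1 by rewrite fine_ge0// levy_exponent_ge0.
have /andP[a0 a1] := a01.
have PF e : 0 < e -> ((expR (- e))%:E <= P F)%E.
  move=> e0; pose t := (e / (c1 + 1)) `^ alpha^-1.
  have ec0 : 0 < e / (c1 + 1) by rewrite divr_gt0// ltr_wpDl.
  have t0 : 0 < t by rewrite powR_gt0.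
  have ta : t `^ alpha = e / (c1 + 1).
    by rewrite -powRrM mulVf ?gt_eqF// powRr1// ltW.
  have ct : fine (levy_exponent alpha t) <= e.
    rewrite levy_exponent_scale// fineM ?levy_exponent_fin_num//= ta.
    by rewrite -/c1 mulrAC ler_pdivrMr ?ltr_wpDl// ler_pM2l// lerDl.
  apply: (@le_trans _ _ (expR (- fine (levy_exponent alpha t)))%:E).
    by rewrite lee_fin ler_expR lerN2.
  rewrite -integral_laplace_weight// -[P F]mul1e -integral_cst//.
  rewrite [leRHS]integral_mkcond; apply: ge0_le_integral => //.
  - by move=> x _; rewrite lee_fin /laplace_weight; case: ifP => // _; rewrite expR_ge0.
  - by apply/measurable_EFinP; exact: measurable_laplace_weight.
  - by apply/(measurable_restrictT (cst 1%E)) => //; exact: measurable_cst.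
  - move=> x _; rewrite patchE /laplace_weight.
    case: ifPn => [fx|nx]; last by case: ifPn => // _; rewrite lee_fin.
    rewrite mem_set//= lee_fin expR_le1 oppr_le0 mulr_ge0 ?(ltW t0)//.
    by apply: fine_ge0; apply: nneseries_ge0 => j _ _; rewrite lee_fin powR_ge0.
have PF1 : P F = 1%E.
  apply/eqP; rewrite eq_le probability_le1//= ; apply/lee_addgt0Pr => e e0.
  have := PF e e0; rewrite -(fineK (fin_num_measure P F mF)) lee_fin => h.
  rewrite -EFinD lee_fin -lerBlDr; apply: le_trans h.
  exact: expR_ge1Dx.
exists (~` F); split => //; first exact: measurableC.
by rewrite probability_setC// PF1 subee.
Qed.

Lemma integral_exp_scaled_gamma_series (beta k : R) : 0 < beta -> 0 < k ->
  (\int[P]_x (expR (- (k * scaled_gamma_series alpha E beta x)))%:E =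
   (expR (- fine (levy_exponent alpha (k * beta))))%:E)%E.
Proof.
move=> b0 k0; have kb0 : 0 < k * beta by rewrite mulr_gt0.
rewrite -integral_laplace_weight//; apply: ge0_ae_eq_integral => //.
- apply/measurable_EFinP; apply: measurableT_comp => //; apply: measurable_funN.
  by apply: measurable_funM => //; exact: measurable_scaled_gamma_series.
- by apply/measurable_EFinP; exact: measurable_laplace_weight.
- by move=> x _; rewrite lee_fin /laplace_weight; case: ifP => // _; rewrite expR_ge0.
- apply: filterS ae_gamma_series_lty => x gx _.
  by rewrite /laplace_weight gx /scaled_gamma_series mulrA.
Qed.

End gamma_series_laplace.

(** * Weierstrass approximation on the unit interval *)

Section weierstrass.
Context (R : realType).

(** The Bernstein polynomial of the values [g 0, .., g n], as the expectation of
    [g] at the number of successes in [n] trials; the recursion conditions on the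
    first trial. *)
Fixpoint bernstein (n : nat) (g : nat -> R) : {poly R} :=
  if n is m.+1 then
    (1 - 'X) * bernstein m g + 'X * bernstein m (fun k => g k.+1)
  else (g 0)%:P.

Lemma bernsteinS (n : nat) (g : nat -> R) (x : R) :
  (bernstein n.+1 g).[x] = (1 - x) * (bernstein n g).[x] +
    x * (bernstein n (fun k => g k.+1)).[x].
Proof. by rewrite /= !hornerE. Qed.

Lemma bernsteinD (n : nat) (f g : nat -> R) (x : R) :
  (bernstein n (fun k => f k + g k)).[x] = (bernstein n f).[x] + (bernstein n g).[x].
Proof.
elim: n f g => [|n IH] f g; first by rewrite /= !hornerE.
by rewrite !bernsteinS !IH; ring.
Qed.

Lemma bernsteinZ (n : nat) (a : R) (g : nat -> R) (x : R) :
  (bernstein n (fun k => a * g k)).[x] = a * (bernstein n g).[x].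
Proof.
elim: n g => [|n IH] g; first by rewrite /= !hornerE.
by rewrite !bernsteinS !IH; ring.
Qed.

Lemma bernstein_cst (n : nat) (a x : R) : (bernstein n (fun=> a)).[x] = a.
Proof.
elim: n => [|n IH]; first by rewrite /= !hornerE.
by rewrite bernsteinS IH; ring.
Qed.

Lemma ler_bernstein (n : nat) (f g : nat -> R) (x : R) : 0 <= x <= 1 ->
  (forall k, (k <= n)%N -> f k <= g k) -> (bernstein n f).[x] <= (bernstein n g).[x].
Proof.
move=> /andP[x0 x1]; elim: n f g => [|n IH] f g fg.
  by rewrite /= !hornerE; exact: fg.
rewrite !bernsteinS lerD// ler_wpM2l ?subr_ge0//; apply: IH => k kn; apply: fg.
  exact: leqW.
by [].
Qed.

Lemma bernstein_variance (n : nat) (a x : R) :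
  (bernstein n (fun k => (k%:R - a) ^+ 2)).[x] =
  n%:R * (x * (1 - x)) + (n%:R * x - a) ^+ 2.
Proof.
elim: n a => [|n IH] a; first by rewrite /= !hornerE; ring.
rewrite bernsteinS IH.
have -> : (fun k : nat => (k.+1%:R - a) ^+ 2) = (fun k => (k%:R - (a - 1)) ^+ 2) :> (nat -> R).
  by apply/funext => k; rewrite -natr1; ring.
by rewrite IH -natr1; ring.
Qed.

Lemma continuous_uniform_itv01 (f : R -> R) (e : R) : continuous f -> 0 < e ->
  exists2 r, 0 < r & forall x y, 0 <= x <= 1 -> `|x - y| < r -> `|f x - f y| <= e.
Proof.
move=> cf e0; have /compact_near_coveringP cov := @segment_compact R 0 1.
have := cov R (0^'+) (fun r x => forall y, `|x - y| < r -> `|f x - f y| <= e) _.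
case=> [x _|r r0 h].
  have e2 : 0 < e / 2 by rewrite divr_gt0.
  have /cvgrPdist_lt/(_ _ e2)/nbhs_ballP[r /= r0 hr] := cf x.
  have r2 : 0 < r / 2 by rewrite divr_gt0.
  exists (ball x (r / 2), [set s | s < r / 2]).
    by split => /=; [exact: nbhsx_ballx|exact: nbhs_right_lt].
  move=> [z s] /= [xz sr] y zy.
  have hz : `|f x - f z| < e / 2.
    by apply: hr; apply: (le_ball _ xz); lra.
  have hy : `|f x - f y| < e / 2.
    apply: hr; rewrite /ball/= (splitr r) -(subrK z x) -addrA.
    apply: le_lt_trans (ler_normD _ _) _; apply: ltrD => //.
    exact: lt_trans sr.
  rewrite -(subrK (f x) (f z)) -addrA; apply: le_trans (ler_normD _ _) _.
  by rewrite (splitr e) distrC lerD ?ltW.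
have {}r0 : 0 < r := r0.
have : exists s, [/\ 0 < s, s < r & True].
  by exists (r / 2); split => //; lra.
move=> [s [s0 sr _]]; exists s => // x y x01.
by apply: (h s) => //=; rewrite /ball/= sub0r normrN gtr0_norm.
Qed.

(** Weierstrass approximation, through Chebyshev's inequality for Bernstein
    polynomials. *)
Lemma weierstrass_itv01 (f : R -> R) (M e : R) : continuous f ->
  (forall x, `|f x| <= M) -> 0 < e ->
  exists p : {poly R}, forall x, 0 <= x <= 1 -> `|f x - p.[x]| <= e.
Proof.
move=> cf fM e0; have e2 : 0 < e / 2 by rewrite divr_gt0.
have [r r0 hr] := continuous_uniform_itv01 cf e2.
have M0 : 0 <= M by apply: le_trans (fM 0); rewrite normr_ge0.
(* With this constant, [C * (x - y) ^+ 2] exceeds [2 * M] once [`|x - y|] is at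
   least [r]. *)
pose C := 2 * M / r ^+ 2.
have C0 : 0 <= C by rewrite /C divr_ge0 ?sqr_ge0// mulr_ge0.
pose n := (Num.truncn (C / (e / 2))).+1.
have n0 : 0 < n%:R :> R by rewrite ltr0n.
have nC : C / n%:R <= e / 2.
  by rewrite ler_pdivrMr// mulrC -ler_pdivrMr// ltW// truncnS_gt.
exists (bernstein n (fun k => f (k%:R / n%:R))) => x x01.
have key k : (k <= n)%N -> `|f x - f (k%:R / n%:R)| <=
    e / 2 + C / n%:R ^+ 2 * (k%:R - n%:R * x) ^+ 2.
  move=> kn; pose y := k%:R / n%:R : R; rewrite -/y.
  have -> : C / n%:R ^+ 2 * (k%:R - n%:R * x) ^+ 2 = C * (x - y) ^+ 2.
    have -> : k%:R - n%:R * x = - n%:R * (x - y).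
      by rewrite /y; field; rewrite gt_eqF.
    by field; rewrite gt_eqF.
  have [xy|xy] := ltP `|x - y| r.
    apply: le_trans (hr _ _ x01 xy) _.
    by rewrite lerDl mulr_ge0// sqr_ge0.
  apply: (@le_trans _ _ (2 * M)).
    by apply: le_trans (ler_normB _ _) _; rewrite mulr2n mulrDl mul1r lerD.
  apply: (@le_trans _ _ (C * (x - y) ^+ 2)); last by rewrite lerDr ltW.
  rewrite /C mulrAC ler_pdivlMr ?exprn_gt0// ler_wpM2l ?mulr_ge0//.
  by rewrite -(real_normK (num_real (x - y))) lerXn2r// nnegrE ?ltW ?normr_ge0.
(* [s] is the sign of the difference, so that the monotonicity of [bernstein] in
   the sampled function gives a two-sided bound. *)
have bound (s : R) : `|s| = 1 ->
    s * (f x - (bernstein n (fun k => f (k%:R / n%:R))).[x]) <= e.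
  move=> s1; pose g k := s * (f x + -1 * f (k%:R / n%:R)).
  have -> : s * (f x - (bernstein n (fun k => f (k%:R / n%:R))).[x]) =
      (bernstein n g).[x].
    by rewrite bernsteinZ bernsteinD bernsteinZ bernstein_cst mulN1r.
  apply: (@le_trans _ _ (bernstein n (fun k => e / 2 +
      C / n%:R ^+ 2 * (k%:R - n%:R * x) ^+ 2)).[x]).
    apply: ler_bernstein => // k kn; apply: le_trans (key k kn).
    by apply: le_trans (ler_norm _) _; rewrite normrM s1 mul1r mulN1r.
  rewrite bernsteinD bernstein_cst bernsteinZ bernstein_variance subrr expr0n addr0.
  have x1 : x * (1 - x) <= 1.
    have /andP[x0 x1] := x01; rewrite mulr_ile1 ?subr_ge0// lerBlDr lerDl//.
  rewrite [leRHS](splitr e) lerD2l; apply: le_trans nC.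
  rewrite (_ : C / n%:R ^+ 2 * _ = C / n%:R * (x * (1 - x))); last first.
    by field; rewrite gt_eqF.
  by rewrite ler_piMr// divr_ge0// ltW.
have [h|h] := leP 0 (f x - (bernstein n (fun k => f (k%:R / n%:R))).[x]).
  by rewrite ger0_norm//; have := bound 1 (normr1 R); rewrite mul1r.
have := bound (-1); rewrite normrN1 => /(_ erefl).
by rewrite mulN1r ltr0_norm.
Qed.

End weierstrass.

(** * From Laplace transforms to convergence in distribution *)

Section bounded_expectation.
Context (R : realType) (d : measure_display) (T : measurableType d)
  (P : probability T R).

Lemma integrable_bounded (f : T -> R) (c : R) :
  measurable_fun [set: T] f -> (forall w, `|f w| <= c) ->
  P.-integrable [set: T] (EFin \o f).
Proof.
move=> mf fc; apply: (@le_integrable _ _ _ P [set: T] _ _ (EFin \o cst c)) => //.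
- exact/measurable_EFinP.
- by move=> w _ /=; rewrite lee_fin (le_trans (fc w))// ler_norm.
- exact: finite_measure_integrable_cst.
Qed.

Lemma Rintegral_prob_cst (c : R) : \int[P]_w c = c.
Proof. by rewrite Rintegral_cst//= probability_setT mulr1. Qed.

Lemma norm_Rintegral_le (f : T -> R) (c : R) :
  measurable_fun [set: T] f -> (forall w, `|f w| <= c) ->
  `|\int[P]_w f w| <= c.
Proof.
move=> mf fc; have fi := integrable_bounded mf fc.
apply: (le_trans (le_normr_Rintegral _ fi)) => //.
rewrite -[leRHS]Rintegral_prob_cst; apply: le_Rintegral => //.
- exact: integrable_norm.
- exact: finite_measure_integrable_cst.
Qed.

Lemma dist_Rintegral_le (f g h : T -> R) (a b c : R) :
  measurable_fun [set: T] f -> (forall w, `|f w| <= a) ->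
  measurable_fun [set: T] g -> (forall w, `|g w| <= b) ->
  measurable_fun [set: T] h -> (forall w, `|h w| <= c) ->
  (forall w, `|f w - g w| <= h w) ->
  `|\int[P]_w f w - \int[P]_w g w| <= \int[P]_w h w.
Proof.
move=> mf fa mg gb mh hc fgh.
have fi := integrable_bounded mf fa.
have gi := integrable_bounded mg gb.
have hi := integrable_bounded mh hc.
have fgi : P.-integrable [set: T] (EFin \o (fun w => f w - g w)).
  apply: (@integrable_bounded _ c); first exact: measurable_funB.
  by move=> w; apply: le_trans (fgh w) _; apply: le_trans (hc w); exact: ler_norm.
rewrite -RintegralB//; apply: (le_trans (le_normr_Rintegral _ fgi)) => //.
by apply: le_Rintegral => //; exact: (integrable_norm fgi).
Qed.

End bounded_expectation.

Section moments.
Context (R : realType) (d : nat -> measure_display)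
  (T : forall n, measurableType (d n)) (P : forall n, probability (T n) R)
  (d' : measure_display) (T' : measurableType d') (P' : probability T' R)
  (U : forall n, T n -> R) (U' : T' -> R).
Hypotheses (mU : forall n, measurable_fun [set: T n] (@U n))
  (mU' : measurable_fun [set: T'] U').
Hypotheses (U01 : forall n w, 0 <= @U n w <= 1) (U'01 : forall w, 0 <= U' w <= 1).
Hypothesis momU : forall k : nat,
  \int[P n]_w (U w ^+ k) @[n --> \oo] --> \int[P']_w (U' w ^+ k).

Let norm_pow (x : R) (k : nat) : 0 <= x <= 1 -> `|x ^+ k| <= 1.
Proof. by move=> /andP[x0 x1]; rewrite normrX ger0_norm// exprn_ile1. Qed.

Lemma cvg_poly_moments (p : {poly R}) :
  \int[P n]_w p.[U w] @[n --> \oo] --> \int[P']_w p.[U' w].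
Proof.
have key (d0 : measure_display) (T0 : measurableType d0) (P0 : probability T0 R)
    (V : T0 -> R) : measurable_fun [set: T0] V -> (forall w, 0 <= V w <= 1) ->
    \int[P0]_w p.[V w] = \sum_(i < size p) p`_i * \int[P0]_w (V w ^+ i).
  move=> mV V01; under eq_Rintegral do rewrite horner_coef.
  have iV i : P0.-integrable [set: T0] (EFin \o (fun w => V w ^+ i)).
    apply: (@integrable_bounded _ _ _ _ _ 1); first exact: measurable_funX.
    by move=> w; exact: norm_pow.
  elim: (size p) => [|n IH].
    by rewrite big_ord0; under eq_Rintegral do rewrite big_ord0;
      exact: Rintegral_prob_cst.
  rewrite big_ord_recr/= -IH; under eq_Rintegral do rewrite big_ord_recr/=.
  rewrite RintegralD//; last 2 first.
  - apply: (@integrable_bounded _ _ _ _ _ (\sum_(i < n) `|p`_i|)).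
      by apply: measurable_sum => i; apply: measurable_funM => //; exact: measurable_funX.
    move=> w; apply: le_trans (ler_norm_sum _ _ _) _; apply: ler_sum => i _.
    by rewrite normrM ler_piMr// norm_pow.
  - apply: (@integrable_bounded _ _ _ _ _ `|p`_n|).
      by apply: measurable_funM => //; exact: measurable_funX.
    by move=> w; rewrite normrM ler_piMr// norm_pow.
  by rewrite RintegralZl.
rewrite key//; under eq_fun do rewrite key//.
apply: cvg_big => [|i _]; first exact: add_continuous.
  apply: cvgM; first exact: cvg_cst.
exact: momU.
Qed.

(** Moments determine the means of polynomials, which approximate continuous
    functions uniformly on [[0, 1]]. *)
Lemma cvg_continuous_moments (f : R -> R) (M : R) :
  continuous f -> (forall x, `|f x| <= M) ->
  \int[P n]_w f (U w) @[n --> \oo] --> \int[P']_w f (U' w).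
Proof.
move=> cf fM; apply/cvgrPdist_le => e e0.
have e3 : 0 < e / 3 by rewrite divr_gt0.
have [p hp] := weierstrass_itv01 cf fM e3.
have mf : measurable_fun [set: R] f by exact: continuous_measurable_fun.
have mp : measurable_fun [set: R] (horner p).
  by apply: continuous_measurable_fun; exact: continuous_horner.
have key (d0 : measure_display) (T0 : measurableType d0) (P0 : probability T0 R)
    (V : T0 -> R) : measurable_fun [set: T0] V -> (forall w, 0 <= V w <= 1) ->
    `|\int[P0]_w f (V w) - \int[P0]_w p.[V w]| <= e / 3.
  move=> mV V01; rewrite -[leRHS](Rintegral_prob_cst P0).
  apply: (@dist_Rintegral_le _ _ _ _ _ _ _ M (M + e / 3) `|e / 3|) => //.
  - exact: measurableT_comp.
  - exact: measurableT_comp.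
  - move=> w; rewrite -(subrK (f (V w)) p.[V w]) addrC.
    by apply: le_trans (ler_normD _ _) _; rewrite lerD// distrC hp.
  - by move=> w; exact: hp.
have := @cvg_poly_moments p; move=> /cvgrPdist_le/(_ _ e3); apply: filterS => n h.
have h1 := key _ _ P' _ mU' U'01; have h2 := key _ _ (P n) _ (@mU n) (@U01 n).
set a := \int[P']_w f (U' w) in h1 *; set b := \int[P n]_w f (U w) in h2 *.
set a' := \int[P']_w p.[U' w] in h1 h *; set b' := \int[P n]_w p.[U w] in h2 h *.
have -> : a - b = (a - a') + (a' - b') + (b' - b) by ring.
have -> : e = e / 3 + e / 3 + e / 3 by field.
apply: le_trans (ler_normD _ _) _; apply: lerD; last by rewrite distrC.
by apply: le_trans (ler_normD _ _) _; exact: lerD.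
Qed.

End moments.

Section laplace_continuity.
Context (R : realType).

(** Cut-off vanishing at [0], used to transport a function of [y] in [0, +oo[ to
    a continuous function of [expR (- y)]. *)
Definition cutoff (m : nat) (u : R) : R := Num.min 1 (Num.max 0 (m%:R * u)).

Lemma cutoff_ge0 m u : 0 <= cutoff m u.
Proof. by rewrite /cutoff le_min ler01 le_max lexx. Qed.

Lemma cutoff_le1 m u : cutoff m u <= 1.
Proof. by rewrite /cutoff ge_min lexx. Qed.

Lemma continuous_cutoff m : continuous (cutoff m).
Proof.
move=> u; have cm : {for u, continuous (fun x : R => m%:R * x)}.
  by apply: cvgM; [exact: cvg_cst|].
have c0 : {for u, continuous (cst 0 : R -> R)} by exact: cst_continuous.
have c1 : {for u, continuous (cst 1 : R -> R)} by exact: cst_continuous.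
exact: (continuous_min c1 (continuous_max c0 cm)).
Qed.

Lemma continuous_cutoff_ln (f : R -> R) (M : R) (m : nat) : continuous f ->
  (forall x, `|f x| <= M) -> continuous (fun u => cutoff m u * f (- ln u)).
Proof.
move=> cf fM x; have [x0|x0] := ltP 0 x.
  apply: cvgM; first exact: continuous_cutoff.
  apply: cvg_comp; [|exact: cf]; apply: cvgN; exact: continuous_ln.
have cx0 : cutoff m x = 0.
  rewrite /cutoff (_ : Num.max 0 _ = 0) ?(min_idPr _)//.
  by apply/max_idPl; rewrite mulr_ge0_le0.
rewrite /continuous_at cx0 mul0r.
have Mc : M * cutoff m u @[u --> x] --> (0 : R).
  by rewrite -(mulr0 M) -cx0; apply: cvgM; [exact: cvg_cst|exact: continuous_cutoff].
apply/cvgrPdist_le => e e0; move/cvgrPdist_le : Mc => /(_ e e0); apply: filterS => u.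
rewrite !sub0r !normrN; apply: le_trans; rewrite !normrM mulrC.
rewrite ler_wpM2r//; apply: le_trans (fM _) _; exact: ler_norm.
Qed.

Context (d : nat -> measure_display)
  (T : forall n, measurableType (d n)) (P : forall n, probability (T n) R)
  (d' : measure_display) (T' : measurableType d') (P' : probability T' R)
  (Y : forall n, {RV (P n) >-> R}) (Y' : {RV P' >-> R}).

(** The variable [expR (- Y)] lives in [[0, 1]], where convergence of moments is
    enough, and its moments are the values of the Laplace transform of [Y] at the
    integers. Since [f (- ln u)] need not be continuous at [u = 0], it is cut off
    there; the limit [Y'] being finite, this costs little in the limit, hence also
    for large [n]. *)
Lemma cvg_in_distribution_laplace :
  (\forall n \near \oo, forall w, 0 <= Y n w) -> (forall w, 0 <= Y' w) ->
  (forall k : nat, (0 < k)%N -> \int[P n]_w expR (- (k%:R * Y n w)) @[n --> \oo] -->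
    \int[P']_w expR (- (k%:R * Y' w))) ->
  cvg_in_distribution Y Y'.
Proof.
move=> Ypos Y'0 LY f cf bf.
have [M fM] : exists M, forall x, `|f x| <= M.
  have [M [_ HM]] := bf; exists (M + 1) => x.
  by apply: HM => //; rewrite ltrDl.
have M0 : 0 <= M by apply: le_trans (fM 0).
(* The minimum with [1] acts only for the first few [n], where [Y n] may be
   negative. *)
pose U n w := Num.min 1 (expR (- Y n w)).
pose U' w := Num.min 1 (expR (- Y' w)).
have mfexp (d0 : measure_display) (T0 : measurableType d0) (V : T0 -> R) :
    measurable_fun [set: T0] V -> measurable_fun [set: T0] (fun w => Num.min 1 (expR (- V w))).
  move=> mV; apply: measurable_minr => //; apply: measurableT_comp => //.
  exact: measurable_funN.
have mU n : measurable_fun [set: T n] (U n) by exact: mfexp.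
have mU' : measurable_fun [set: T'] U' by exact: mfexp.
have U01 n w : 0 <= U n w <= 1 by rewrite le_min ler01 expR_ge0 ge_min lexx.
have U'01 w : 0 <= U' w <= 1 by rewrite le_min ler01 expR_ge0 ge_min lexx.
have UE n : (forall w, 0 <= Y n w) -> forall w, U n w = expR (- Y n w).
  by move=> Yn w; apply/min_idPr; rewrite expR_le1 oppr_le0.
have U'E w : U' w = expR (- Y' w).
  by apply/min_idPr; rewrite expR_le1 oppr_le0.
have mom (k : nat) : \int[P n]_w (U n w ^+ k) @[n --> \oo] --> \int[P']_w (U' w ^+ k).
  case: k => [|k].
    rewrite (_ : (fun n => \int[P n]_w (U n w ^+ 0)) = cst 1); last first.
      by apply/funext => n /=; under eq_Rintegral do rewrite expr0; exact: Rintegral_prob_cst.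
    rewrite (_ : \int[P']_w (U' w ^+ 0) = 1); first exact: cvg_cst.
    by under eq_Rintegral do rewrite expr0; exact: Rintegral_prob_cst.
  rewrite (_ : \int[P']_w (U' w ^+ k.+1) = \int[P']_w expR (- (k.+1%:R * Y' w)));
    last by apply: eq_Rintegral => w _; rewrite U'E -expRM_natl mulrN.
  apply: cvg_trans (LY k.+1 _) => //; apply: near_eq_cvg.
  apply: filterS Ypos => n Yn; apply: eq_Rintegral => w _.
  by rewrite UE// -expRM_natl mulrN.
have mf : measurable_fun [set: R] f by exact: continuous_measurable_fun.
pose phi m u := cutoff m u * f (- ln u).
have cphi m : continuous (phi m) by exact: continuous_cutoff_ln.
have phiM m u : `|phi m u| <= M.
  rewrite normrM -[leRHS]mul1r ler_pM//.
  by rewrite ger0_norm ?cutoff_ge0 ?cutoff_le1.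
have mcut m : measurable_fun [set: R] (cutoff m).
  by apply: continuous_measurable_fun; exact: continuous_cutoff.
(* [q m] bounds the error made by the cut-off. *)
pose q m u := M * (1 - cutoff m u).
have cq m : continuous (q m).
  move=> u; apply: cvgM; first exact: cvg_cst.
  by apply: cvgB; [exact: cvg_cst|exact: continuous_cutoff].
have q0 m u : 0 <= q m u by rewrite mulr_ge0// subr_ge0 cutoff_le1.
have qM m u : `|q m u| <= M.
  rewrite ger0_norm// ler_piMr// lerBlDr lerDl; exact: cutoff_ge0.
have cost (d0 : measure_display) (T0 : measurableType d0) (P0 : probability T0 R)
    (V : T0 -> R) m : measurable_fun [set: T0] V ->
    `|\int[P0]_w f (V w) - \int[P0]_w phi m (expR (- V w))| <=
    \int[P0]_w q m (expR (- V w)).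
  move=> mV.
  have mV' : measurable_fun [set: T0] (fun w => expR (- V w)).
    by apply: measurableT_comp => //; exact: measurable_funN.
  apply: (@dist_Rintegral_le _ _ _ _ _ _ _ M M M) => //.
  - exact: measurableT_comp.
  - by apply: measurableT_comp => //; exact: continuous_measurable_fun.
  - by apply: measurableT_comp => //; exact: continuous_measurable_fun.
  - move=> w; rewrite /phi expRK opprK -{1}[f (V w)]mul1r -mulrBl normrM.
    by rewrite ger0_norm ?subr_ge0 ?cutoff_le1// mulrC ler_wpM2r ?subr_ge0 ?cutoff_le1.
have q_lim : \int[P']_w q m (U' w) @[m --> \oo] --> (0 : R).
  have := @dominated_convergence _ _ _ P' [set: T'] measurableT
    (fun m w => (q m (U' w))%:E) (cst 0%E) (cst M%:E).
  case.
  - move=> m; apply/measurable_EFinP.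
    by apply: measurableT_comp => //; exact: continuous_measurable_fun.
  - exact: measurable_cst.
  - apply: aeW => w _ /=; apply: cvg_EFin; first exact: nearW.
    have U'0 : 0 < U' w by rewrite U'E expR_gt0.
    apply: cvg_near_cst; exists (Num.truncn (U' w)^-1).+1 => // m /= hm.
    have h : 1 <= m%:R * U' w.
      rewrite -ler_pdivrMr// div1r ltW//; apply: lt_le_trans (truncnS_gt _) _.
      by rewrite ler_nat.
    rewrite /q /cutoff (max_idPr _) ?(min_idPl _) ?subrr ?mulr0//.
    exact: le_trans h.
  - exact: finite_measure_integrable_cst.
  - by apply: aeW => w m _ /=; rewrite lee_fin.
  rewrite /= integral0 => _ _ h; exact: (fine_cvg h).
have main : \int[P n]_w f (Y n w) @[n --> \oo] --> \int[P']_w f (Y' w).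
  apply/cvgrPdist_le => e e0.
  have e4 : 0 < e / 4 by rewrite divr_gt0.
  have [m hm] : exists m, \int[P']_w q m (U' w) <= e / 4.
    move/cvgrPdist_le : q_lim => /(_ _ e4)[m _ /(_ m (leqnn m))].
    by rewrite sub0r normrN => h; exists m; apply: le_trans h; exact: ler_norm.
  have := cvg_continuous_moments mU mU' U01 U'01 mom (cphi m) (phiM m).
  move=> /cvgrPdist_le/(_ _ e4).
  have := cvg_continuous_moments mU mU' U01 U'01 mom (cq m) (qM m).
  move=> /cvgrPdist_le/(_ _ e4).
  move=> Hq Hphi; near=> n.
  have Yn : forall w, 0 <= Y n w by near: n.
  have hq : `|\int[P']_w q m (U' w) - \int[P n]_w q m (U n w)| <= e / 4 by near: n.
  have hp : `|\int[P']_w phi m (U' w) - \int[P n]_w phi m (U n w)| <= e / 4 by near: n.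
  have h1 := cost _ _ P' Y' m (@measurable_funPT _ _ _ _ Y').
  have h2 := cost _ _ (P n) (Y n) m (@measurable_funPT _ _ _ _ (Y n)).
  have E1 : \int[P']_w q m (expR (- Y' w)) = \int[P']_w q m (U' w).
    by apply: eq_Rintegral => w _; rewrite U'E.
  have E2 : \int[P']_w phi m (expR (- Y' w)) = \int[P']_w phi m (U' w).
    by apply: eq_Rintegral => w _; rewrite U'E.
  have E3 : \int[P n]_w q m (expR (- Y n w)) = \int[P n]_w q m (U n w).
    by apply: eq_Rintegral => w _; rewrite UE.
  have E4 : \int[P n]_w phi m (expR (- Y n w)) = \int[P n]_w phi m (U n w).
    by apply: eq_Rintegral => w _; rewrite UE.
  rewrite E1 E2 in h1; rewrite E3 E4 in h2.
  move: h1 h2 hq hp hm; rewrite !ler_norml => /andP[? ?] /andP[? ?] /andP[? ?] /andP[? ?] ?.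
  by apply/andP; split; lra.
have fin (d0 : measure_display) (T0 : measurableType d0) (P0 : probability T0 R)
    (V : {RV P0 >-> R}) : ('E_P0[f \o V])%E = (\int[P0]_w f (V w))%:E.
  rewrite unlock /Rintegral fineK//; apply: integrable_fin_num => //.
  apply: (@integrable_bounded _ _ _ _ _ M) => //.
  exact: measurableT_comp.
rewrite fin; under eq_fun do rewrite fin.
by apply: cvg_comp main _; exact: cvg_id.
Unshelve. all: by end_near. Qed.

End laplace_continuity.

(** * Regularly varying tails *)

Lemma mul_predn_bin2 (n : nat) : (n * n.-1 = 2 * 'C(n, 2))%N.
Proof. by rewrite -mul_bin_diag bin1. Qed.

Lemma cvg_bin2 : 'C(n, 2) @[n --> \oo] --> \oo.
Proof.
apply/cvgnyPge => A; exists (A + 2)%N => // n /= hn.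
apply: (@leq_trans n.-1); first by lia.
have := mul_predn_bin2 n.
have : (2 * n.-1 <= n * n.-1)%N by rewrite leq_mul2r; lia.
lia.
Qed.

Section regular_variation.
Context (R : realType) (alpha : R) (G : R -> R) (a : nat -> R).
Hypothesis a01 : 0 < alpha < 1.
Hypothesis G_gt0 : forall x : R, 0 < x -> 0 < G x.
Hypothesis G_le1 : forall x : R, 0 < x -> G x <= 1.
Hypothesis G_ninc : forall x y : R, 0 < x -> x <= y -> G y <= G x.
Hypothesis G_rv : forall t : R, 0 < t -> G (t * x) / G x @[x --> +oo] --> t `^ (- alpha).
Hypothesis a_upper : forall (n : nat) (x : R), 0 < x -> a n < x -> n%:R * G x <= 1.
Hypothesis a_lower : forall (n : nat) (x : R), 0 < x -> x < a n -> 1 < n%:R * G x.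

Lemma scale_cvgy : a n @[n --> \oo] --> +oo.
Proof.
apply/cvgryPge => A; pose B := Num.max A 1.
have B0 : 0 < B by rewrite lt_max ltr01 orbT.
exists (Num.truncn (G B)^-1).+1 => // n /= hn.
apply: (@le_trans _ _ B); first by rewrite le_max lexx.
rewrite leNgt; apply/negP => aB; have := a_upper B0 aB.
rewrite leNgt => /negP; apply; rewrite -ltr_pdivrMr ?G_gt0// div1r.
by apply: lt_le_trans (truncnS_gt _) _; rewrite ler_nat.
Qed.

(** The product [n%:R * G x] crosses [1] at [a n]. Regular variation compares
    [G (a n * x)] with [G (a n * z)] and [G (a n / z)] for [z > 1] close to [1], the
    points where the two one-sided inequalities are available. *)
Lemma scaled_tail_cvg (x : R) : 0 < x ->
  n%:R * G (a n * x) @[n --> \oo] --> x `^ (- alpha).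
Proof.
move=> x0; apply/cvgrPdist_le => e e0.
have e2 : 0 < e / 2 by rewrite divr_gt0.
have /cvgrPdist_le/(_ _ e2)/nbhs_ballP[r /= r0 hr] := @continuous_powR R (- alpha) x x0.
pose h := r / (2 * x); have h0 : 0 < h by rewrite divr_gt0// mulr_gt0.
pose z := 1 + h; have z1 : 1 < z by rewrite ltrDl.
have z0 : 0 < z by apply: lt_trans z1.
have hup : (x / z) `^ (- alpha) <= x `^ (- alpha) + e / 2.
  have := hr (x / z); rewrite /ball/= => /(_ _)H.
  have : `|x - x / z| < r.
    rewrite ger0_norm; last by rewrite subr_ge0 ler_pdivrMr// ler_peMr ?ltW.
    have -> : x - x / z = x * h / z by rewrite /z; field; rewrite gt_eqF.
    rewrite ltr_pdivrMr//; have -> : x * h = r / 2.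
      by rewrite /h; field; rewrite gt_eqF.
    have := ltr_pM2l r0 1 z; rewrite z1 mulr1 => ?; lra.
  by move/H; rewrite ler_norml => /andP[]; lra.
have hlo : x `^ (- alpha) - e / 2 <= (x * z) `^ (- alpha).
  have := hr (x * z); rewrite /ball/= => /(_ _)H.
  have : `|x - x * z| < r.
    have -> : x - x * z = - (r / 2) by rewrite /z /h; field; rewrite gt_eqF.
    by rewrite normrN ger0_norm ?divr_ge0 ?ltW// ltr_pdivrMr// ltr_pMr// ltr1n.
  by move/H; rewrite ler_norml => /andP[]; lra.
have up : G (x / z * (a n * z)) / G (a n * z) @[n --> \oo] --> (x / z) `^ (- alpha).
  have az : a n * z @[n --> \oo] --> +oo.
    by apply: (cvg_comp _ _ scale_cvgy (gt0_cvgMly z0 cvg_id)).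
  exact: (cvg_comp _ _ az (G_rv (divr_gt0 x0 z0))).
have lo : G (x * z * (a n / z)) / G (a n / z) @[n --> \oo] --> (x * z) `^ (- alpha).
  have az : a n / z @[n --> \oo] --> +oo.
    by apply: (cvg_comp _ _ scale_cvgy (gt0_cvgMly _ cvg_id)); rewrite invr_gt0.
  exact: (cvg_comp _ _ az (G_rv (mulr_gt0 x0 z0))).
move/cvgrPdist_le : up => /(_ _ e2) up; move/cvgrPdist_le : lo => /(_ _ e2) lo.
have apos : \forall n \near \oo, 0 < a n.
  by move/cvgryPgt : scale_cvgy; exact.
near=> n.
have an : 0 < a n by near: n.
have up' : `|(x / z) `^ (- alpha) - G (x / z * (a n * z)) / G (a n * z)| <= e / 2.
  by near: n.
have lo' : `|(x * z) `^ (- alpha) - G (x * z * (a n / z)) / G (a n / z)| <= e / 2.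
  by near: n.
have Eu : x / z * (a n * z) = a n * x by field; rewrite gt_eqF.
have El : x * z * (a n / z) = a n * x by field; rewrite gt_eqF.
rewrite Eu in up'; rewrite El in lo'.
have Gz : 0 < G (a n * z) by rewrite G_gt0// mulr_gt0.
have Gz' : 0 < G (a n / z) by rewrite G_gt0// divr_gt0.
have Gx : 0 < G (a n * x) by rewrite G_gt0// mulr_gt0.
have u1 : n%:R * G (a n * x) <= G (a n * x) / G (a n * z).
  rewrite ler_pdivlMr// mulrAC -[leRHS]mul1r ler_wpM2r ?(ltW Gx)//.
  by apply: a_upper; rewrite ?mulr_gt0// ltr_pMr.
have l1 : G (a n * x) / G (a n / z) <= n%:R * G (a n * x).
  rewrite ler_pdivrMr// mulrAC -[leLHS]mul1r ler_wpM2r ?(ltW Gx)// ltW//.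
  by apply: a_lower; rewrite ?divr_gt0// ltr_pdivrMr// ltr_pMr.
move: up' lo'; rewrite !ler_norml => /andP[? ?] /andP[? ?].
by apply/andP; split; lra.
Unshelve. all: by end_near. Qed.

Variable k : R.
Hypothesis ak : alpha < k.

Let k0 : 0 < k. Proof. by have /andP[+ _] := a01 => /lt_trans; apply. Qed.

(** The limit of [G (2 * x) / G x] is [2 `^ (- alpha)], which is larger than
    [2 `^ (- k)]. *)
Lemma tail_doubling : exists2 x0 : R, 0 < x0 &
  forall x : R, x0 <= x -> G x <= 2 `^ k * G (2 * x).
Proof.
have h : 2 `^ (- k) < 2 `^ (- alpha) :> R.
  rewrite -ltr_ln ?posrE ?powR_gt0// !ln_powR ltr_pM2r ?ln_gt0 ?ltr1n//.
  by rewrite ltrN2.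
have := G_rv (ltr0n _ 2); move/cvgrPdist_lt.
have : 0 < 2 `^ (- alpha) - 2 `^ (- k) :> R by rewrite subr_gt0.
move=> e0 /(_ _ e0)[M [_ HM]]; exists (Num.max M 0 + 1).
  by rewrite ltr_wpDl// le_max lexx orbT.
move=> x Mx; have x0 : 0 < x.
  by apply: lt_le_trans Mx; rewrite ltr_wpDl// le_max lexx orbT.
have : M < x by apply: lt_le_trans Mx; rewrite ltr_pwDr// le_max lexx.
move/HM; rewrite ltr_norml => /andP[_].
rewrite ltrD2l ltrN2 powRN ltr_pdivlMr ?G_gt0// => H.
by rewrite -ler_pdivrMl ?powR_gt0// ltW.
Qed.

(** Potter's bound, by iterated doubling from [x] to [y]. *)
Lemma tail_power_bound : exists2 x0 : R, 0 < x0 &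
  forall x y : R, x0 <= x -> x <= y -> G x <= (2 * y / x) `^ k * G y.
Proof.
have [x0 x00 dbl] := tail_doubling; exists x0 => // x y.
have [m ym] : exists m : nat, y < 2 ^+ m * x0.
  exists (Num.truncn (y / x0)).+1.
  rewrite -ltr_pdivrMr//; apply: lt_le_trans (truncnS_gt _) _.
  by rewrite -natrX ler_nat ltnW// ltn_expl.
move=> x0x xy; have {ym} : y < 2 ^+ m * x.
  by apply: lt_le_trans ym _; rewrite ler_pM2l// exprn_gt0.
elim: m x x0x xy => [|m IH] x x0x xy ym.
  by move: ym; rewrite expr0 mul1r ltNge xy.
have xp : 0 < x by apply: lt_le_trans x0x.
have yp : 0 < y by apply: lt_le_trans xy.
have [y2|y2] := ltP y (2 * x).
  apply: (le_trans (dbl _ x0x)); apply: ler_pM; rewrite ?powR_ge0//.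
  - by rewrite ltW// G_gt0// mulr_gt0.
  - apply: ge0_ler_powR; rewrite ?nnegrE ?(ltW k0)//.
      by rewrite divr_ge0 ?mulr_ge0 ?ltW.
    by rewrite ler_pdivlMr// ler_pM2l.
  - by apply: G_ninc => //; exact: ltW.
apply: (le_trans (dbl _ x0x)).
have := IH (2 * x); rewrite mulrA -exprSr => /(_ _ y2 ym) H.
apply: le_trans (ler_wpM2l (powR_ge0 _ _) (H _)) _.
  by apply: (le_trans x0x); rewrite ler_peMl ?ltW// ltr1n.
rewrite mulrA -powRM//; last by rewrite divr_ge0 ?mulr_ge0 ?(ltW xp) ?(ltW yp).
by rewrite (_ : 2 * (2 * y / (2 * x)) = 2 * y / x)//; field; rewrite gt_eqF.
Qed.

(** Domination of the scaled tails by a function that is integrable at [0] when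
    [k < 1]. For [x] below [1], Potter's bound goes from [a n * x] to [2 * a n], where
    [n%:R * G] is at most [1]. *)
Lemma scaled_tail_bound : exists2 C : R, 0 < C &
  \forall n \near \oo, forall x : R, 0 < x -> n%:R * G (a n * x) <= C * (1 + x `^ (- k)).
Proof.
have [x0 x00 pot] := tail_power_bound.
pose C := 4 `^ k / G x0 + 1.
have C0 : 0 < C by rewrite ltr_wpDl// divr_ge0 ?powR_ge0// ltW// G_gt0.
exists C => //.
have ax0 : \forall n \near \oo, x0 <= a n.
  by move/cvgryPge : scale_cvgy; exact.
apply: filterS ax0 => n an x xp.
have anp : 0 < a n by apply: lt_le_trans an.
have C1 : C * (1 + x `^ (- k)) = 4 `^ k / G x0 * x `^ (- k) + 1 + (4 `^ k / G x0 + x `^ (- k)).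
  by rewrite /C; ring.
have pos : 0 <= 4 `^ k / G x0 + x `^ (- k).
  by rewrite addr_ge0 ?powR_ge0// divr_ge0 ?powR_ge0// ltW// G_gt0.
have pos' : 0 <= 4 `^ k / G x0 * x `^ (- k).
  by rewrite mulr_ge0 ?powR_ge0// divr_ge0 ?powR_ge0// ltW// G_gt0.
have [x1|x1] := ltP 1 x.
  apply: (@le_trans _ _ 1); last by rewrite C1; lra.
  by apply: a_upper; rewrite ?mulr_gt0// ltr_pMr.
apply: (@le_trans _ _ (4 `^ k / G x0 * x `^ (- k))); last by rewrite C1; lra.
have G2 : n%:R * G (2 * a n) <= 1.
  by apply: a_upper; rewrite ?mulr_gt0// ltr_pMl// ltr1n.
have Gx0 := G_gt0 x00.
have key y : x0 <= y -> y <= a n -> n%:R * G y <= (4 * (a n / y)) `^ k.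
  move=> x0y ya; have yp : 0 < y by apply: lt_le_trans x0y.
  have H := pot y (2 * a n) x0y (_ : y <= 2 * a n).
  have {}H : G y <= (2 * (2 * a n) / y) `^ k * G (2 * a n) by apply: H; lra.
  apply: le_trans (ler_wpM2l (ler0n _ n) H) _.
  rewrite mulrCA -[leRHS]mulr1 (_ : 2 * (2 * a n) / y = 4 * (a n / y)); last by ring.
  by rewrite ler_wpM2l ?powR_ge0.
have xE : 4 `^ k * x `^ (- k) = (4 * x^-1) `^ k.
  by rewrite powRM ?invr_ge0 ?ltW// -[x^-1]powR_inv1 ?ltW// -powRrM mulN1r.
rewrite mulrAC xE.
have p4 : 0 <= (4 * x^-1) `^ k by rewrite powR_ge0.
have [ax|ax] := leP x0 (a n * x).
  apply: le_trans (key _ ax _) _; first by rewrite ler_piMr// ltW.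
  rewrite (_ : a n / (a n * x) = x^-1); last by field; rewrite !gt_eqF.
  by rewrite ler_pdivlMr// ler_piMr// G_le1.
rewrite ler_pdivlMr//; apply: (@le_trans _ _ (n%:R * G x0)).
  by rewrite mulrAC ler_piMr ?G_le1 ?mulr_gt0// mulr_ge0// ltW.
apply: le_trans (key _ _ an) _; first exact: lexx.
apply: ge0_ler_powR; rewrite ?nnegrE ?(ltW k0)//.
- by rewrite mulr_ge0// divr_ge0// ltW.
- by rewrite mulr_ge0// invr_ge0 ltW.
- rewrite ler_pM2l// ler_pdivrMr// mulrC ler_pdivlMr//; exact: ltW.
Qed.

(** At [a n / 2] the tail [G] is at least [1 / n], while [scaled_tail_bound] for
    [M = 'C(n, 2)] bounds [M * G] there by a constant times [1 + b `^ k]. Hence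
    [n - 1] is at most of order [1 + b `^ k], which is incompatible with
    [b < n / e] for large [n] because [k < 1]. *)
Lemma scale_ratio_cvg : k < 1 ->
  n%:R / ((a n)^-1 * a 'C(n, 2)) @[n --> \oo] --> (0 : R).
Proof.
move=> k1; have [C C0 bnd] := scaled_tail_bound.
have binE n : (1 < n)%N -> n%:R * (n%:R - 1) = 2 * ('C(n, 2))%:R :> R.
  move=> n1; have /(congr1 (fun m => m%:R : R)) := mul_predn_bin2 n.
  by rewrite !natrM -subn1 natrB// ltnW.
apply/cvgrPdist_le => e e0.
pose D := 4 * C * (2 / e) `^ k.
have D0 : 0 <= D by rewrite !mulr_ge0 ?powR_ge0// ltW.
have k1' : 0 < 1 - k by rewrite subr_gt0.
pose L := Num.max (8 * C + 2) ((2 * D + 1) `^ (1 - k)^-1).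
have apos : \forall n \near \oo, 0 < a n by move/cvgryPgt : scale_cvgy; exact.
have aposM : \forall n \near \oo, 0 < a 'C(n, 2) by exact: (@cvg_bin2 _ apos).
have bndM := @cvg_bin2 _ bnd.
near=> n; have an : 0 < a n by near: n.
have aM : 0 < a 'C(n, 2) by near: n.
have bn : forall x : R, 0 < x -> 'C(n, 2)%:R * G (a 'C(n, 2) * x) <= C * (1 + x `^ (- k)).
  by near: n.
have Ln : L <= n%:R by near: n; exact: nbhs_infty_ger.
have nC : 8 * C + 2 <= n%:R by apply: le_trans Ln; rewrite le_max lexx.
have nD : (2 * D + 1) `^ (1 - k)^-1 <= n%:R by apply: le_trans Ln; rewrite le_max lexx orbT.
have n0 : 0 < n%:R :> R by lra.
have n1 : (1 < n)%N by rewrite -(ltr_nat R); lra.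
pose b := (a n)^-1 * a 'C(n, 2); have b0 : 0 < b by rewrite mulr_gt0// invr_gt0.
have nb0 : 0 <= n%:R / b by rewrite divr_ge0 ?ltW.
rewrite -/b sub0r normrN ger0_norm// leNgt; apply/negP => h.
have bne : b < n%:R / e by rewrite ltr_pdivlMr// mulrC -ltr_pdivlMr.
have an2 : 0 < a n / 2 by rewrite divr_gt0.
have G1 : 1 < n%:R * G (a n / 2) by apply: a_lower => //; lra.
have := bn (a n / 2 / a 'C(n, 2)); rewrite divr_gt0// => /(_ isT).
rewrite (_ : a 'C(n, 2) * (a n / 2 / a 'C(n, 2)) = a n / 2); last first.
  by field; rewrite gt_eqF.
rewrite (_ : (a n / 2 / a 'C(n, 2)) `^ (- k) = (2 * b) `^ k); last first.
  rewrite (_ : a n / 2 / a 'C(n, 2) = (2 * b)^-1); last first.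
    by rewrite /b; field; rewrite !gt_eqF.
  by rewrite -[(2 * b)^-1]powR_inv1 -?powRrM ?mulN1r ?opprK// mulr_ge0// ltW.
move=> H.
have M0 : 0 < 'C(n, 2)%:R :> R by rewrite ltr0n bin_gt0.
have Hn : n%:R - 1 <= 2 * (C * (1 + (2 * b) `^ k)).
  have : 'C(n, 2)%:R < n%:R * (C * (1 + (2 * b) `^ k)).
    apply: lt_le_trans (_ : n%:R * ('C(n, 2)%:R * G (a n / 2)) <= _).
      by rewrite mulrCA ltr_pMr.
    by rewrite ler_pM2l.
  rewrite -(ltr_pM2l (ltr0n _ 2)) -binE// mulrCA ltr_pM2l//; exact: ltW.
have bk : (2 * b) `^ k <= (2 / e) `^ k * n%:R `^ k.
  rewrite -powRM ?divr_ge0 ?(ltW e0)//; apply: ge0_ler_powR; rewrite ?nnegrE ?(ltW k0)//.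
  - by rewrite mulr_ge0// ltW.
  - by rewrite mulr_ge0 ?divr_ge0// ltW.
  - by rewrite mulrAC -mulrA ler_pM2l// ltW.
have nk : (2 * D + 1) * n%:R `^ k <= n%:R.
  rewrite [leRHS](_ : _ = n%:R `^ (1 - k) * n%:R `^ k); last first.
    by rewrite -powRD ?subrK ?powRr1 ?(ltW n0)// gt_eqF ?implybT.
  rewrite ler_wpM2r ?powR_ge0//.
  have D1 : 0 <= 2 * D + 1 by lra.
  rewrite [leLHS](_ : _ = ((2 * D + 1) `^ (1 - k)^-1) `^ (1 - k)); last first.
    by rewrite -powRrM mulVf ?gt_eqF// powRr1.
  apply: ge0_ler_powR; rewrite ?nnegrE ?powR_ge0 ?(ltW k1') ?(ltW n0)//.
have nk0 : 0 < n%:R `^ k :> R by rewrite powR_gt0.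
have Cb : C * (2 * b) `^ k <= C * ((2 / e) `^ k * n%:R `^ k) by rewrite ler_pM2l.
have DE : D * n%:R `^ k = 4 * (C * ((2 / e) `^ k * n%:R `^ k)) by rewrite /D; ring.
have {}nk : 2 * (D * n%:R `^ k) + n%:R `^ k <= n%:R by move: nk; rewrite mulrDl mul1r mulrA.
rewrite mulrDr mulr1 in Hn.
lra.
Unshelve. all: by end_near. Qed.

End regular_variation.

(** * Laplace transform of a heavy-tailed variable *)

Section heavy_tail.
Context (R : realType) (d : measure_display) (T : measurableType d)
  (P : probability T R) (X : {RV P >-> R}) (L : R -> R) (alpha : R).
Hypothesis a01 : 0 < alpha < 1.
Hypothesis L_gt0 : forall x : R, 0 < x -> 0 < L x.
Hypothesis L_slow : slowly_varying L.
Hypothesis X_tail : forall x : R, 0 < x ->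
  P [set w | x < `|X w|] = (L x / x `^ alpha)%:E.

Definition abs_tail (x : R) : R := fine (P [set w | x < `|X w|]).

Let a := scaling P X.

Lemma measurable_absX : measurable_fun [set: T] (fun w => `|X w|).
Proof. exact: measurableT_comp. Qed.

Let absX : {RV P >-> R} := @mfun_Sub _ _ T R _ (mem_set measurable_absX).

Lemma abs_tail_ccdf (x : R) : P [set w | x < `|X w|] = ccdf absX x.
Proof.
rewrite /ccdf /distribution/= /pushforward/=; congr (P _).
by apply/seteqP; split => w /=; rewrite in_itv/= andbT.
Qed.

Lemma abs_tailE (x : R) : (abs_tail x)%:E = P [set w | x < `|X w|].
Proof.
rewrite /abs_tail fineK//; apply: fin_num_measure.
exact: (measurable_superlevel measurable_absX).
Qed.

Lemma measurable_abs_tail : measurable_fun [set: R] abs_tail.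
Proof.
rewrite (_ : abs_tail = fine \o ccdf absX).
  by apply: measurableT_comp => //; exact: ccdf_measurable.
by apply/funext => x; rewrite /abs_tail abs_tail_ccdf.
Qed.

Lemma abs_tail_gt0 (x : R) : 0 < x -> 0 < abs_tail x.
Proof. by move=> x0; rewrite /abs_tail X_tail//= divr_gt0 ?L_gt0 ?powR_gt0. Qed.

Lemma abs_tail_ge0 (x : R) : 0 <= abs_tail x.
Proof. by rewrite fine_ge0. Qed.

Lemma abs_tail_le1 (x : R) : abs_tail x <= 1.
Proof.
rewrite -lee_fin abs_tailE probability_le1//.
exact: (measurable_superlevel measurable_absX).
Qed.

Lemma abs_tail_ninc (x y : R) : x <= y -> abs_tail y <= abs_tail x.
Proof.
move=> xy; rewrite -lee_fin !abs_tailE; apply: le_measure; rewrite ?inE;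
  do ?exact: (measurable_superlevel measurable_absX).
by move=> w /=; exact: le_lt_trans.
Qed.

Lemma abs_tail_cvg0 : abs_tail x @[x --> +oo] --> (0 : R).
Proof.
have := cvg_ccdfy0 absX => /fine_cvg.
by apply: cvg_trans; apply: near_eq_cvg; apply: nearW => x; rewrite /= -abs_tail_ccdf.
Qed.

Lemma abs_tail_rv (t : R) : 0 < t ->
  abs_tail (t * x) / abs_tail x @[x --> +oo] --> t `^ (- alpha).
Proof.
move=> t0.
have h : L (t * x) / L x * t `^ (- alpha) @[x --> +oo] --> 1 * t `^ (- alpha).
  by apply: cvgM; [exact: L_slow|exact: cvg_cst].
rewrite mul1r in h; apply: cvg_trans h; apply: near_eq_cvg.
near=> x; have x0 : 0 < x by near: x; apply: nbhs_pinfty_gt; rewrite num_real.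
rewrite /abs_tail !X_tail ?mulr_gt0//= powRM ?(ltW t0) ?(ltW x0)// powRN.
have ? : x `^ alpha != 0 by rewrite gt_eqF// powR_gt0.
have ? : t `^ alpha != 0 by rewrite gt_eqF// powR_gt0.
have ? : L x != 0 by rewrite gt_eqF// L_gt0.
by field; apply/and3P; split.
Unshelve. all: by end_near. Qed.

Let S (n : nat) := [set x : R | 0 < x /\
  (n%:R%:E * P [set w | (x < `|X w|)%R] <= 1)%E].

Let SE n (x : R) : S n x = (0 < x /\ n%:R * abs_tail x <= 1).
Proof. by rewrite /S /= -abs_tailE -EFinM lee_fin. Qed.

Let S_has_inf n : has_inf (S n).
Proof.
split; last by exists 0 => x; rewrite SE => -[x0 _]; exact: ltW.
have e0 : 0 < (n.+1%:R)^-1 :> R by rewrite invr_gt0.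
have := abs_tail_cvg0; move/cvgrPdist_le/(_ _ e0) => [M [_ HM]].
exists (Num.max M 0 + 1); rewrite SE; split.
  by rewrite ltr_wpDl// le_max lexx orbT.
have := HM (Num.max M 0 + 1); rewrite ltr_pwDr ?le_max ?lexx// => /(_ isT).
rewrite sub0r normrN ger0_norm ?abs_tail_ge0// => h.
apply: (@le_trans _ _ (n%:R / n.+1%:R)); first by rewrite ler_wpM2l.
by rewrite ler_pdivrMr// mul1r ler_nat.
Qed.

Lemma scaling_upper (n : nat) (x : R) : 0 < x -> a n < x -> n%:R * abs_tail x <= 1.
Proof.
move=> x0 ax; have xa : 0 < x - a n by rewrite subr_gt0.
have [y] := inf_adherent xa (S_has_inf n); rewrite SE => -[y0 yn].
rewrite -/(scaling P X n) -/(a n) addrC subrK => yx.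
by apply: le_trans yn; rewrite ler_wpM2l// abs_tail_ninc// ltW.
Qed.

Lemma scaling_lower (n : nat) (x : R) : 0 < x -> x < a n -> 1 < n%:R * abs_tail x.
Proof.
move=> x0 xa; rewrite ltNge; apply/negP => h.
have : a n <= x by apply: ge_inf; [exact: proj2 (S_has_inf n)|rewrite -[X in X x]/(S n) SE].
by rewrite leNgt xa.
Qed.

Lemma scaling_cvgy : a n @[n --> \oo] --> +oo.
Proof.
by apply: (scale_cvgy (G := abs_tail)); [exact: abs_tail_gt0|exact: scaling_upper].
Qed.

Lemma scaling_gt0 : \forall n \near \oo, 0 < a n.
Proof. by move/cvgryPgt : scaling_cvgy; exact. Qed.

Lemma abs_tail_scaling_cvg (x : R) : 0 < x ->
  n%:R * abs_tail (a n * x) @[n --> \oo] --> x `^ (- alpha).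
Proof.
apply: scaled_tail_cvg.
- exact: abs_tail_gt0.
- exact: abs_tail_rv.
- exact: scaling_upper.
- exact: scaling_lower.
Qed.

Let k := (1 + alpha) / 2.
Let ak : alpha < k. Proof. by rewrite /k; have /andP[] := a01; lra. Qed.
Let k01 : 0 < k < 1.
Proof. by rewrite /k; have /andP[] := a01; move=> *; apply/andP; split; lra. Qed.

Lemma abs_tail_scaling_bound : exists2 C : R, 0 < C &
  \forall n \near \oo, forall x : R, 0 < x ->
    n%:R * abs_tail (a n * x) <= C * (1 + x `^ (- k)).
Proof.
apply: (scaled_tail_bound a01) => //.
- exact: abs_tail_gt0.
- by move=> x _; exact: abs_tail_le1.
- by move=> x y _; exact: abs_tail_ninc.
- exact: abs_tail_rv.
- exact: scaling_upper.
Qed.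

Lemma scaling_ratio_cvg : n%:R / scaling_ratio P X n @[n --> \oo] --> (0 : R).
Proof.
have /andP[k0 k1] := k01.
apply: (scale_ratio_cvg a01 _ _ _ _ _ _ ak k1).
- exact: abs_tail_gt0.
- by move=> x _; exact: abs_tail_le1.
- by move=> x y _; exact: abs_tail_ninc.
- exact: abs_tail_rv.
- exact: scaling_upper.
- exact: scaling_lower.
Qed.

(** Layer cake: [1 - expR (- (t * y))] exceeds [u] exactly when [y] exceeds
    [level t u]. *)
Lemma laplace_tail (t s : R) : 0 < t -> 0 < s ->
  (\int[P]_w (1 - expR (- (t * (`|X w| / s))))%:E =
   \int[lebesgue_measure]_(u in `]0%R, 1%R[) (abs_tail (s * level t u))%:E)%E.
Proof.
move=> t0 s0; pose f w := 1 - expR (- (t * (`|X w| / s))).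
have f0 w : 0 <= f w.
  by rewrite subr_ge0 expR_le1 oppr_le0 mulr_ge0 ?divr_ge0// ltW.
have mf : measurable_fun [set: T] f.
  apply: measurable_funB => //; apply: measurableT_comp => //.
  apply: measurable_funN; apply: measurable_funM => //.
  by apply: measurable_funM => //; exact: measurable_absX.
rewrite (layer_cake mf f0 P) integral_mkcond [RHS]integral_mkcond.
apply: eq_integral => u _; rewrite !patchE.
case: ifPn; rewrite ?inE ?notin_setE/= in_itv/= ?andbT => u0; last first.
  rewrite memNset//= in_itv/= => /andP[/negP]; exact.
case: ifPn; rewrite ?inE ?notin_setE/= in_itv/= u0/= => u1.
  rewrite abs_tailE; congr (P _); apply/seteqP; split => w /=; rewrite /f.
    rewrite ltrBrDr -ltrBrDl => h; rewrite mulrC -ltr_pdivlMr// /level.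
    rewrite ltr_pdivrMr// mulrC ltrNl -ltr_expR lnK// posrE subr_gt0//.
  rewrite mulrC -ltr_pdivlMr// /level ltr_pdivrMr// mulrC ltrNl.
  rewrite -ltr_expR lnK ?posrE ?subr_gt0//.
  by move=> h; rewrite ltrBrDr -ltrBrDl.
rewrite (_ : [set x | u < f x] = set0) ?measure0//.
apply/seteqP; split => w //=; rewrite /f; apply/negP; rewrite -leNgt.
apply: (@le_trans _ _ 1); last by rewrite leNgt; exact/negP.
by rewrite lerBlDr lerDl expR_ge0.
Qed.

(** Dominated convergence in [laplace_tail], the scaled tails converging to a power
    by [abs_tail_scaling_cvg]. *)
Lemma laplace_tail_cvg (t : R) : 0 < t ->
  n%:R * \int[P]_w (1 - expR (- (t * (`|X w| / a n)))) @[n --> \oo] -->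
    fine (levy_exponent alpha t).
Proof.
move=> t0; have [C C0 Cb] := abs_tail_scaling_bound.
have [n0 _ Hn0] : \forall n \near \oo, 0 < a n /\ forall x : R, 0 < x ->
    n%:R * abs_tail (a n * x) <= C * (1 + x `^ (- k)).
  by near=> n; split; near: n; [exact: scaling_gt0|exact: Cb].
pose D : set (measurableTypeR R) := `]0, 1[%classic.
have mD : measurable D by exact: measurable_itv.
have mlev (B : set R) : measurable_fun B (level t).
  by apply: measurable_funTS; exact: measurable_level.
have mlevk (b : R) : measurable_fun D (fun u : R => (level t u `^ b)%:E).
  apply/measurable_EFinP; apply: (measurableT_comp (measurable_powR _)).
  exact: mlev.
pose f n (u : R) := (n%:R * abs_tail (a n * level t u))%:E : \bar R.
have mf n : measurable_fun D (f n).
  apply/measurable_EFinP; apply: measurable_funM => //.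
  apply: (measurableT_comp measurable_abs_tail); apply: measurable_funM => //.
  exact: mlev.
have := @dominated_convergence _ _ _ (@lebesgue_measure R) D mD
  (fun n => f (n + n0)%N) (fun u => (level t u `^ (- alpha))%:E)
  (fun u => (C * (1 + level t u `^ (- k)))%:E).
case => //.
- apply: aeW => u; rewrite /D/= in_itv/= => u01.
  apply: cvg_EFin; first exact: nearW.
  rewrite (_ : fine \o _ = fun n => (n + n0)%:R * abs_tail (a (n + n0)%N * level t u))//.
  rewrite (cvg_shiftn n0 (fun n => n%:R * abs_tail (a n * level t u))).
  by apply: abs_tail_scaling_cvg; exact: level_gt0.
- have iD : (@lebesgue_measure R).-integrable D (EFin \o cst (1 : R)).
    apply: (@integrableS _ _ _ _ (`[0, 1]%classic : set (measurableTypeR R))).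
    - exact: measurable_itv.
    - exact: measurable_itv.
    - by apply: subset_itvW.
    - apply: continuous_compact_integrable; first exact: segment_compact.
      by apply: continuous_subspaceT => x; exact: cst_continuous.
  have ik : (@lebesgue_measure R).-integrable D (fun u => (level t u `^ (- k))%:E).
    apply/integrableP; split; first exact: mlevk.
    under eq_integral do rewrite gee0_abs ?lee_fin ?powR_ge0//.
    exact: levy_exponent_lty.
  have i1 : (@lebesgue_measure R).-integrable D
      ((EFin \o cst 1%R) \+ (fun u => (level t u `^ (- k))%:E))%E.
    exact: integrableD.
  have := integrableZl mD C i1.
  by apply: eq_integrable => // u _; rewrite /= EFinM EFinD.
- apply: aeW => u n; rewrite /D/= in_itv/= => u01.
  have [ap h] := Hn0 (n + n0)%N (leq_addl _ _).
  rewrite lee_fin ger0_norm ?mulr_ge0 ?abs_tail_ge0//.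
  by apply: h; exact: level_gt0.
- move=> _ _ h.
  have {}h : (\int[lebesgue_measure]_(u in D) f (n + n0)%N u)%E @[n --> \oo] -->
      (fine (levy_exponent alpha t))%:E.
    by rewrite fineK ?levy_exponent_fin_num.
  rewrite -(cvg_shiftn n0).
  move/fine_cvg : h; apply: cvg_trans; apply: near_eq_cvg; apply: nearW => n.
  have [an _] := Hn0 (n + n0)%N (leq_addl _ _).
  rewrite /= /Rintegral laplace_tail// /f.
  under eq_integral do rewrite EFinM.
  rewrite ge0_integralZl_EFin//.
    rewrite fineM//.
    rewrite -laplace_tail//; apply: integrable_fin_num => //.
    apply: (@integrable_bounded _ _ _ _ _ 1).
      apply: measurable_funB => //; apply: measurableT_comp => //.
      apply: measurable_funN; apply: measurable_funM => //.
      by apply: measurable_funM => //; exact: measurable_absX.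
    move=> w; have e1 : expR (- (t * (`|X w| / a (n + n0)%N))) <= 1.
      by rewrite expR_le1 oppr_le0 mulr_ge0 ?divr_ge0 ?(ltW t0) ?(ltW an).
    by rewrite ger0_norm ?subr_ge0// lerBlDr lerDl expR_ge0.
  - by move=> u _; rewrite lee_fin abs_tail_ge0.
  - apply/measurable_EFinP; apply: (measurableT_comp measurable_abs_tail).
    by apply: measurable_funM => //; exact: mlev.
Unshelve. all: by end_near. Qed.

End heavy_tail.

(** * Deterministic bounds on the partition function *)

Section edges.
Context (N : nat).

Definition edges : seq ('I_N * 'I_N) :=
  [seq p : 'I_N * 'I_N <- enum {: 'I_N * 'I_N} | (p.1 < p.2)%N].

Lemma mem_edges (p : 'I_N * 'I_N) : (p \in edges) = (p.1 < p.2)%N.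
Proof. by rewrite mem_filter mem_enum andbT. Qed.

Lemma edges_uniq : uniq edges.
Proof. by rewrite filter_uniq// enum_uniq. Qed.

Lemma sum_edges (V : nmodType) (F : 'I_N -> 'I_N -> V) :
  \sum_(i < N) \sum_(j < N | (i < j)%N) F i j = \sum_(p <- edges) F p.1 p.2.
Proof. by rewrite pair_big_dep/= big_filter big_enum_cond. Qed.

Lemma size_edges : size edges = 'C(N, 2).
Proof.
have := @sum_edges nat (fun _ _ => 1%N).
rewrite sum1_size => <-; rewrite (exchange_big_dep predT)//=.
rewrite -bin2_sum big_mkord; apply: eq_bigr => j _.
rewrite -(big_ord_widen N (fun=> 1%N)) ?sum1_card ?card_ord//.
exact: ltnW.
Qed.

End edges.

Section hamiltonian.
Context (R : realType) (N : nat) (beta : R) (x : 'I_N -> 'I_N -> R).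
Hypothesis beta0 : 0 < beta.

Let spins := {ffun 'I_N -> bool}.

Definition energy (s : spins) : R :=
  \sum_(p <- edges N) x p.1 p.2 * (-1) ^+ s p.1 * (-1) ^+ s p.2.

Definition total_coupling : R := \sum_(p <- edges N) `|x p.1 p.2|.

Lemma partition_functionE :
  partition_function beta x = \sum_(s : spins) expR (beta * energy s).
Proof. by apply: eq_bigr => s _; rewrite (sum_edges (fun i j => _)). Qed.

Let norm_spin (b : bool) : `|(-1) ^+ b| = 1 :> R.
Proof. by rewrite normrX normrN1 expr1n. Qed.

Lemma energy_le (s : spins) : energy s <= total_coupling.
Proof.
apply: ler_sum => p _; apply: (le_trans (ler_norm _)).
by rewrite !normrM !norm_spin !mulr1.
Qed.

Lemma partition_function_gt0 : 0 < partition_function beta x.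
Proof.
rewrite partition_functionE (bigD1 [ffun=> false])//= ltr_pwDl ?expR_gt0//.
by apply: sumr_ge0 => s _; rewrite expR_ge0.
Qed.

Lemma ln_partition_ge (s : spins) :
  beta * energy s <= ln (partition_function beta x).
Proof.
rewrite -ler_expR lnK ?posrE ?partition_function_gt0//.
rewrite partition_functionE (bigD1 s)//= lerDl.
by apply: sumr_ge0 => ? _; rewrite expR_ge0.
Qed.

Lemma ln_partition_le :
  ln (partition_function beta x) <= N%:R * ln 2 + beta * total_coupling.
Proof.
rewrite -ler_expR lnK ?posrE ?partition_function_gt0// expRD.
rewrite expRM_natl lnK ?posrE// partition_functionE.
apply: (@le_trans _ _ (\sum_(s : spins) expR (beta * total_coupling))).
  by apply: ler_sum => s _; rewrite ler_expR ler_pM2l// energy_le.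
by rewrite sumr_const card_ffun card_bool card_ord -[leLHS]mulr_natl natrX.
Qed.

(** The energy averages to zero over all configurations: flipping the spin at
    one end of an edge reverses the contribution of that edge. *)
Lemma sum_energy : \sum_(s : spins) energy s = 0.
Proof.
rewrite exchange_big/= big1_seq//= => p; rewrite mem_edges => p12.
pose flip (s : spins) : spins := [ffun v => if v == p.1 then ~~ s v else s v].
have flipK : involutive flip.
  by move=> s; apply/ffunP => v; rewrite !ffunE; case: (v == p.1); rewrite ?negbK.
set S := \sum_(s : spins) _.
have SN : S = - S.
  rewrite {1}/S (reindex_inj (inv_inj flipK)) /S -sumrN; apply: eq_bigr => s _.
  rewrite !ffunE eqxx (gtn_eqF p12 : (p.2 == p.1) = false).
  by case: (s p.1) => /=; ring.
by apply/eqP; rewrite -[_ == _](mulrn_eq0 S 2) mulr2n {1}SN addNr.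
Qed.

(** As the mean energy is zero, some configuration has nonnegative energy. *)
Lemma ln_partition_ge0 : 0 <= ln (partition_function beta x).
Proof.
have [s Hs] : exists s, 0 <= energy s.
  apply/not_existsP => h.
  have : \sum_(s : spins) energy s < \sum_(s : spins) 0.
    apply: ltr_sum => [|s _]; last by rewrite ltNge; apply/negP; exact: h.
    by apply/hasP; exists [ffun=> false] => //; rewrite mem_index_enum.
  by rewrite sum_energy big1 // ltxx.
by apply: le_trans (ln_partition_ge s); rewrite mulr_ge0// ltW.
Qed.

Variable large : rel 'I_N.
Hypothesis large_inj : forall i j k, large i k -> large j k -> i = j.
Hypothesis large_chain : forall i j k, large i j -> large j k -> False.

(** If no two large edges meet except at their lower ends, all of them can be
    satisfied at once by orienting the spin at the upper end of each. *)
Lemma satisfy_large : exists s : spins, forall i j, large i j ->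
  x i j * (-1) ^+ s i * (-1) ^+ s j = `|x i j|.
Proof.
exists [ffun v => if [pick i | large i v] is Some i then x i v < 0 else false].
move=> i j lij; rewrite !ffunE.
case: pickP => [k lki|_]; first by have := large_chain lki lij.
case: pickP => [k lkj|/(_ i)]; last by rewrite lij.
rewrite (large_inj lkj lij) expr0 mulr1.
by case: ltP => h; rewrite ?expr0 ?expr1 ?mulr1 ?mulrN1; [rewrite ltr0_norm|rewrite ger0_norm].
Qed.

(** The configuration of [satisfy_large] loses at most twice the size of each small
    coupling. *)
Lemma ln_partition_ge_matching : beta * (total_coupling -
    2 * \sum_(p <- edges N | ~~ large p.1 p.2) `|x p.1 p.2|) <=
  ln (partition_function beta x).
Proof.
have [s Hs] := satisfy_large.
apply: le_trans (ln_partition_ge s); rewrite ler_pM2l//.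
rewrite big_mkcond mulr_sumr -sumrB; apply: ler_sum => p _.
case: ifPn => [_|/negPn/Hs ->]; last by rewrite mulr0 subr0.
have -> : `|x p.1 p.2| - 2 * `|x p.1 p.2| = - `|x p.1 p.2| by ring.
rewrite lerNl; apply: (le_trans (ler_norm _)).
by rewrite normrN !normrM !norm_spin !mulr1.
Qed.

End hamiltonian.

Section approximation.
Context (R : realType) (N : nat) (beta : R) (x : 'I_N -> 'I_N -> R) (b eps : R).
Hypotheses (beta0 : 0 < beta) (b0 : 0 < b) (eps0 : 0 < eps).

Definition large_edge : rel 'I_N :=
  fun i j => (i < j)%N && (eps < `|x i j| / b).

Lemma le_one_sub_exp (y : R) : 0 <= y -> y <= 1 -> y <= 2 * (1 - expR (- y)).
Proof.
move=> y0 y1; rewrite expRN.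
have y1' : 0 < 1 + y by rewrite ltr_pwDl.
have : (expR y)^-1 <= (1 + y)^-1.
  by rewrite lef_pV2 ?posrE ?expR_gt0// expR_ge1Dx.
have : (1 + y)^-1 <= 1 - y / 2.
  rewrite -div1r ler_pdivrMr//; have := mulr_ge0 y0 (_ : 0 <= 1 - y).
  by rewrite subr_ge0 => /(_ y1); nra.
lra.
Qed.

(** The small couplings are bounded by multiples of [1 - expR (- y / eps)], which
    agrees with [y / eps] up to a factor near [0] but is bounded, so that its mean
    is finite although that of the couplings is not. *)
Lemma ln_partition_approx :
  (forall i j k, large_edge i k -> large_edge j k -> i = j) ->
  (forall i j k, large_edge i j -> large_edge j k -> False) ->
  `|b^-1 * ln (partition_function beta x) - beta * (total_coupling x / b)| <=
    N%:R / b * ln 2 + 2 * beta * \sum_(p <- edges N)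
      2 * eps * (1 - expR (- (eps^-1 * (`|x p.1 p.2| / b)))).
Proof.
move=> inj chain.
have bi0 : 0 < b^-1 by rewrite invr_gt0.
have up := ln_partition_le x beta0.
have lo : beta * (total_coupling x -
    2 * \sum_(p <- edges N | ~~ large_edge p.1 p.2) `|x p.1 p.2|) <=
    ln (partition_function beta x).
  exact: ln_partition_ge_matching.
set S := \sum_(p <- edges N) _.
have small : (\sum_(p <- edges N | ~~ large_edge p.1 p.2) `|x p.1 p.2|) / b <= S.
  rewrite mulr_suml big_mkcond /S big_seq_cond [leRHS]big_seq_cond.
  apply: ler_sum => p /andP[]; rewrite mem_edges => p12 _.
  have y0 : 0 <= `|x p.1 p.2| / b by rewrite divr_ge0// ltW.
  have e1 : expR (- (eps^-1 * (`|x p.1 p.2| / b))) <= 1.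
    by rewrite expR_le1 oppr_le0 mulr_ge0// invr_ge0 ltW.
  case: ifPn; last by move=> _; rewrite !mulr_ge0 ?subr_ge0// ltW.
  rewrite /large_edge p12/= -leNgt; move: y0 e1.
  set y := `|x p.1 p.2| / b; set E := expR _ => y0 e1 ye.
  have h : eps^-1 * y <= 2 * (1 - E).
    apply: le_one_sub_exp; first by rewrite mulr_ge0// invr_ge0 ltW.
    by rewrite mulrC ler_pdivrMr// mul1r.
  have := ler_wpM2l (ltW eps0) h; rewrite mulrA divff ?gt_eqF// mul1r.
  by rewrite mulrA [eps * 2]mulrC.
have S0 : 0 <= S.
  apply: sumr_ge0 => p _; rewrite !mulr_ge0 ?(ltW eps0)// subr_ge0 expR_le1 oppr_le0.
  by rewrite mulr_ge0 ?invr_ge0 ?(ltW eps0)// divr_ge0// ltW.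
have ln2 : 0 <= N%:R / b * ln 2 :> R.
  by rewrite mulr_ge0 ?divr_ge0 ?(ltW b0)// ln_ge0// ler1n.
have bS : 0 <= beta * S by rewrite mulr_ge0// ltW.
rewrite ler_norml; apply/andP; split.
- have := ler_wpM2l (ltW bi0) lo.
  have := ler_wpM2l (ltW beta0) small.
  set r := \sum_(p <- edges N | _) _; set l := ln _; set tc := total_coupling x.
  rewrite (_ : b^-1 * (beta * (tc - 2 * r)) =
    beta * (tc / b) - 2 * (beta * (r / b))); last by ring.
  lra.
- have := ler_wpM2l (ltW bi0) up.
  set l := ln (partition_function _ _); set tc := total_coupling x.
  rewrite mulrDr (_ : b^-1 * (beta * tc) = beta * (tc / b)); last by ring.
  rewrite (_ : b^-1 * (N%:R * ln 2) = N%:R / b * ln 2); last by ring.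
  lra.
Qed.

End approximation.

(** * Comparison of Laplace transforms at finite size *)

Section finite_size.
Context (R : realType) (d0 : measure_display) (T0 : measurableType d0)
  (P0 : probability T0 R) (X : {RV P0 >-> R}) (N : nat)
  (d : measure_display) (T : measurableType d) (P : probability T R)
  (J : 'I_N -> 'I_N -> {RV P >-> R}) (a b : R).
Hypotheses (a0 : 0 < a) (b0 : 0 < b).
Hypothesis Jlaw : forall i j : 'I_N, (i < j)%N ->
  same_law P P0 (J i j) (fun w => a^-1 * X w).
Hypothesis Jindep : mutually_independent [set p : 'I_N * 'I_N | (p.1 < p.2)%N]
  (fun p => J p.1 p.2).

Let M := 'C(N, 2).

Lemma same_law_integral (f : R -> R) (p : 'I_N * 'I_N) :
  measurable_fun [set: R] f -> (forall y, 0 <= y -> 0 <= f y) -> p \in edges N ->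
  (\int[P]_w (f (`|J p.1 p.2 w| / b))%:E =
   \int[P0]_w (f (`|X w| / (a * b)))%:E)%E.
Proof.
move=> mf f0; rewrite mem_edges => p12.
have mXa : measurable_fun [set: T0] (fun w => a^-1 * X w).
  exact: measurable_funM.
pose Xa : {mfun T0 >-> R} := @mfun_Sub _ _ T0 R _ (mem_set mXa).
have mg : measurable_fun [set: R] (fun y => (f (`|y| / b))%:E).
  apply/measurable_EFinP; apply: (measurableT_comp mf).
  by apply: measurable_funM => //; exact: measurableT_comp.
transitivity (\int[distribution P (J p.1 p.2)]_y (f (`|y| / b))%:E)%E.
  by rewrite ge0_integral_distribution// => y; rewrite lee_fin f0// divr_ge0// ltW.
transitivity (\int[distribution P0 Xa]_y (f (`|y| / b))%:E)%E.
  by apply: eq_measure_integral => A mA _; exact: Jlaw.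
rewrite ge0_integral_distribution//; last first.
  by move=> y; rewrite lee_fin f0// divr_ge0// ltW.
apply: eq_integral => w _ /=.
by rewrite normrM normfV (gtr0_norm a0) invfM mulrA [a^-1 * _]mulrC.
Qed.

Definition laplace_defect (t : R) : R :=
  \int[P0]_w (1 - expR (- (t * (`|X w| / (a * b))))).

Let measurable_exp_tail (t : R) : measurable_fun [set: R] (fun y => expR (- (t * y))).
Proof.
by apply: measurableT_comp => //; apply: measurable_funN; exact: measurable_funM.
Qed.

Let measurable_defect (t : R) : measurable_fun [set: R] (fun y => 1 - expR (- (t * y))).
Proof. exact: measurable_funB. Qed.

Let XE0 w : 0 <= `|X w| / (a * b).
Proof. by rewrite divr_ge0// mulr_ge0 ?ltW. Qed.

Let mX : measurable_fun [set: T0] (fun w => `|X w| / (a * b)).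
Proof. by apply: measurable_funM => //; exact: measurableT_comp. Qed.

Let exp_bounds (t y : R) : 0 < t -> 0 <= y -> 0 <= 1 - expR (- (t * y)) <= 1.
Proof.
by move=> t0 y0; rewrite subr_ge0 expR_le1 oppr_le0 mulr_ge0 ?(ltW t0)//=.
Qed.

Let integrable_defect (t : R) : 0 < t ->
  P0.-integrable [set: T0] (EFin \o (fun w => 1 - expR (- (t * (`|X w| / (a * b)))))).
Proof.
move=> t0; apply: (@integrable_bounded _ _ _ _ _ 1).
  exact: (measurableT_comp (measurable_defect t) mX).
by move=> w; have /andP[h0 h1] := exp_bounds t0 (XE0 w); rewrite ger0_norm.
Qed.

Lemma laplace_defect_bounds (t : R) : 0 < t -> 0 <= laplace_defect t <= 1.
Proof.
move=> t0; apply/andP; split.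
  by apply: Rintegral_ge0 => w _; have /andP[] := exp_bounds t0 (XE0 w).
apply: le_trans (ler_norm _) _; apply: norm_Rintegral_le.
  exact: (measurableT_comp (measurable_defect t) mX).
by move=> w; have /andP[h0 h1] := exp_bounds t0 (XE0 w); rewrite ger0_norm.
Qed.

Let laplace_defectE (t : R) : 0 < t ->
  (\int[P0]_w (1 - expR (- (t * (`|X w| / (a * b)))))%:E = (laplace_defect t)%:E)%E.
Proof.
move=> t0; rewrite /laplace_defect /Rintegral fineK// integrable_fin_num//.
exact: integrable_defect.
Qed.

Let laplace_XE (t : R) : 0 < t ->
  (\int[P0]_w (expR (- (t * (`|X w| / (a * b)))))%:E = (1 - laplace_defect t)%:E)%E.
Proof.
move=> t0; rewrite EFinB -laplace_defectE//.
have -> : (1%:E = \int[P0]_w 1%:E)%E by rewrite integral_cst//= probability_setT mule1.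
rewrite -integralB_EFin//; last first.
- exact: integrable_defect.
- exact: finite_measure_integrable_cst.
by apply: eq_integral => w _; rewrite -EFinB; congr EFin; ring.
Qed.

(** By independence, each edge contributes one factor. *)
Lemma laplace_total_coupling (t : R) : 0 < t ->
  \int[P]_w expR (- (t * (total_coupling (fun i j => J i j w) / b))) =
  (1 - laplace_defect t) ^+ M.
Proof.
move=> t0; rewrite /Rintegral.
rewrite (_ : (fun w => _) = fun w => (\prod_(p <- edges N)
    expR (- (t * (`|J p.1 p.2 w| / b))))%:E); last first.
  apply/funext => w; rewrite /total_coupling mulr_suml mulr_sumr -sumrN.
  by rewrite expR_sum.
rewrite (integral_prod_independent Jindep (f := fun _ y => expR (- (t * (`|y| / b)))))//.
- rewrite (eq_big_seq (fun=> (1 - laplace_defect t)%:E)); last first.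
    move=> p pe; rewrite -laplace_XE//.
    by rewrite -(@same_law_integral (fun y => expR (- (t * y))) p).
  by rewrite prodEFin/= big_const_seq count_predT size_edges iter_mulr_1.
- exact: edges_uniq.
- by move=> p /=; rewrite mem_edges.
- move=> p; apply: (measurableT_comp (measurable_exp_tail t)).
  by apply: measurable_funM => //; exact: measurableT_comp.
Qed.

(** Adjacency at the upper end of [p], the situation that the hypotheses of
    [satisfy_large] exclude for large edges. *)
Definition adjacent (p q : 'I_N * 'I_N) : bool :=
  (p != q) && ((p.2 == q.2) || (p.2 == q.1)).

Variable eps : R.
Hypothesis eps0 : 0 < eps.

Definition exceeds (y : R) : R := \1_[set y | eps < y] y.

Lemma measurable_exceeds : measurable_fun [set: R] exceeds.
Proof.
apply: measurable_indic; rewrite (_ : [set y | _] = `]eps, +oo[%classic)//.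
by apply/seteqP; split => y /=; rewrite in_itv/= andbT.
Qed.

Definition collisions (w : T) : R :=
  \sum_(p <- edges N) \sum_(q <- edges N | adjacent p q)
    exceeds (`|J p.1 p.2 w| / b) * exceeds (`|J q.1 q.2 w| / b).

Definition exceedance : R := fine (P0 [set w | eps < `|X w| / (a * b)]).

Lemma count_adjacent (p : 'I_N * 'I_N) :
  (count (adjacent p) (edges N) <= 2 * N)%N.
Proof.
have := count_predUI (fun q : 'I_N * 'I_N => p.2 == q.2) (fun q => p.2 == q.1) (edges N).
have sub : (count (adjacent p) (edges N) <= count
    (predU (fun q : 'I_N * 'I_N => p.2 == q.2) (fun q => p.2 == q.1)) (edges N))%N.
  by apply: sub_count => q /andP[].
have le1 (f g : 'I_N * 'I_N -> 'I_N) : injective (fun q => (f q, g q)) ->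
    (count (fun q => p.2 == f q) (edges N) <= N)%N.
  move=> inj; rewrite -size_filter -(size_map g) -[leqRHS]card_ord.
  rewrite cardE; apply: uniq_leq_size; last by move=> i; rewrite mem_enum.
  rewrite map_inj_in_uniq; first exact/filter_uniq/edges_uniq.
  move=> q r.
  rewrite !mem_filter => /andP[/eqP fq _] /andP[/eqP fr _] gqr.
  by apply: inj; rewrite -fq -fr gqr.
have h1 := le1 snd fst _; have h2 := le1 fst snd _.
have i1 : injective (fun q : 'I_N * 'I_N => (q.2, q.1)) by move=> [? ?] [? ?] [-> ->].
have i2 : injective (fun q : 'I_N * 'I_N => (q.1, q.2)) by move=> [? ?] [? ?] [-> ->].
have := h1 i1; have := h2 i2; move: sub; lia.
Qed.

Let mJ (p : 'I_N * 'I_N) : measurable_fun [set: T] (fun w => `|J p.1 p.2 w| / b).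
Proof. by apply: measurable_funM => //; exact: measurableT_comp. Qed.

Let exceeds_ge0 y : 0 <= exceeds y. Proof. by rewrite /exceeds indicE. Qed.
Let exceeds_le1 y : exceeds y <= 1.
Proof. by rewrite /exceeds indicE; case: (_ \in _). Qed.

Let exceedance_ge0 : 0 <= exceedance. Proof. by rewrite fine_ge0. Qed.

Lemma measurable_collisions : measurable_fun [set: T] collisions.
Proof.
apply: measurable_sum => p; rewrite /=.
rewrite (_ : (fun w => _) = fun w => \sum_(q <- edges N) if adjacent p q then
    exceeds (`|J p.1 p.2 w| / b) * exceeds (`|J q.1 q.2 w| / b) else 0); last first.
  by apply/funext => w; rewrite big_mkcond.
apply: measurable_sum => q; case: (adjacent p q) => //.
by apply: measurable_funM; apply: (measurableT_comp measurable_exceeds).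
Qed.

Lemma collisions_ge0 w : 0 <= collisions w.
Proof. by apply: sumr_ge0 => p _; apply: sumr_ge0 => q _; rewrite mulr_ge0. Qed.

(** First moment bound for two large edges meeting: there are of order [N ^ 3]
    adjacent pairs and two independent exceedances for each. *)
Lemma integral_collisions :
  (\int[P]_w (collisions w)%:E <= (2 * M%:R * N%:R * exceedance ^+ 2)%:E)%E.
Proof.
have exE : (\int[P0]_w (exceeds (`|X w| / (a * b)))%:E = exceedance%:E)%E.
  rewrite /exceeds (eq_integral (fun w => (\1_[set w | eps < `|X w| / (a * b)] w)%:E)).
    rewrite integral_indic//; last exact: measurable_superlevel.
    by rewrite setIT /exceedance fineK// fin_num_measure//; exact: measurable_superlevel.
  by move=> w _; congr EFin; apply: eq_indic.
have two p q : p \in edges N -> q \in edges N -> adjacent p q ->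
  (\int[P]_w (exceeds (`|J p.1 p.2 w| / b) * exceeds (`|J q.1 q.2 w| / b))%:E =
   (exceedance ^+ 2)%:E)%E.
  move=> pe qe /andP[pq _].
  have := integral_prod_independent Jindep (s := [:: p; q])
    (f := fun _ y => exceeds (`|y| / b)).
  rewrite /= inE pq => /(_ isT) H.
  rewrite (eq_integral (fun w =>
    (\prod_(i <- [:: p; q]) exceeds (`|J i.1 i.2 w| / b))%:E)); last first.
    by move=> w _; rewrite !big_cons big_nil mulr1.
  rewrite H//.
  - rewrite !big_cons big_nil mule1 (same_law_integral measurable_exceeds _ pe)//.
    by rewrite (same_law_integral measurable_exceeds _ qe)// exE -EFinM expr2.
  - by move=> r /=; rewrite !inE => /orP[] /eqP ->; rewrite -mem_edges.
  - move=> _; apply: (measurableT_comp measurable_exceeds).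
    by apply: measurable_funM => //; exact: measurableT_comp.
have mpq p q : measurable_fun [set: T]
    (fun w => (exceeds (`|J p.1 p.2 w| / b) * exceeds (`|J q.1 q.2 w| / b))%:E).
  by apply/measurable_EFinP; apply: measurable_funM;
    apply: (measurableT_comp measurable_exceeds).
pose F p w := \sum_(q <- edges N | adjacent p q)
  exceeds (`|J p.1 p.2 w| / b) * exceeds (`|J q.1 q.2 w| / b).
have F0 p w : 0 <= F p w by apply: sumr_ge0 => q _; rewrite mulr_ge0.
have FE p w : (F p w)%:E = (\sum_(q <- [seq q <- edges N | adjacent p q])
    (exceeds (`|J p.1 p.2 w| / b) * exceeds (`|J q.1 q.2 w| / b))%:E)%E.
  by rewrite big_filter sumEFin.
have intF p : p \in edges N -> (\int[P]_w (F p w)%:E <=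
    (2 * N%:R * exceedance ^+ 2)%:E)%E.
  move=> pe; under eq_integral do rewrite FE.
  rewrite ge0_integral_sum//; last by move=> q w _; rewrite lee_fin mulr_ge0.
  rewrite (eq_big_seq (fun=> (exceedance ^+ 2)%:E)); last first.
    by move=> q; rewrite mem_filter => /andP[pq qe]; exact: two.
  rewrite sumEFin lee_fin big_const_seq count_predT size_filter iter_addr_0.
  by rewrite -[leLHS]mulr_natl ler_wpM2r ?exprn_ge0// -natrM ler_nat count_adjacent.
have mF p : measurable_fun [set: T] (fun w => (F p w)%:E).
  under eq_fun do rewrite FE; exact: emeasurable_sum.
under eq_integral do rewrite /collisions -sumEFin.
rewrite ge0_integral_sum//; last by move=> p w _; rewrite lee_fin F0.
apply: (@le_trans _ _ (\sum_(p <- edges N) (2 * N%:R * exceedance ^+ 2)%:E)%E).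
  by rewrite big_seq [leRHS]big_seq; apply: lee_sum => p; exact: intF.
rewrite sumEFin lee_fin big_const_seq count_predT size_edges iter_addr_0.
rewrite /M -[leLHS]mulr_natl le_eqVlt; apply/orP; left; apply/eqP; ring.
Qed.

Variables (beta k : R).
Hypotheses (beta0 : 0 < beta) (k0 : 0 < k).

Let S (w : T) : R := total_coupling (fun i j => J i j w) / b.

Let Y (w : T) : R := b^-1 * ln (partition_function beta (fun i j => J i j w)).

Let small_part (w : T) : R := \sum_(p <- edges N)
  4 * k * beta * eps * (1 - expR (- (eps^-1 * (`|J p.1 p.2 w| / b)))).

Let small_part_term p w :
  0 <= 4 * k * beta * eps * (1 - expR (- (eps^-1 * (`|J p.1 p.2 w| / b))))
    <= 4 * k * beta * eps.
Proof.
have Jb : 0 <= `|J p.1 p.2 w| / b by rewrite divr_ge0// ltW.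
have c0 : 0 <= 4 * k * beta * eps by rewrite !mulr_ge0// ltW.
have ie : 0 < eps^-1 by rewrite invr_gt0.
by have /andP[h0 h1] := exp_bounds ie Jb; rewrite mulr_ge0//= ler_piMr.
Qed.

Let measurable_small_part_term p : measurable_fun [set: T] (fun w =>
  4 * k * beta * eps * (1 - expR (- (eps^-1 * (`|J p.1 p.2 w| / b))))).
Proof.
apply: measurable_funM => //.
exact: (measurableT_comp (measurable_defect eps^-1) (mJ p)).
Qed.

Let integral_small_part : (\int[P]_w (small_part w)%:E =
  (4 * k * beta * eps * (M%:R * laplace_defect eps^-1))%:E)%E.
Proof.
have ie : 0 < eps^-1 by rewrite invr_gt0.
have c0 : 0 <= 4 * k * beta * eps by rewrite !mulr_ge0// ltW.
under eq_integral do rewrite /small_part -sumEFin.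
rewrite ge0_integral_sum//.
- rewrite (eq_big_seq (fun=> (4 * k * beta * eps * laplace_defect eps^-1)%:E)).
    rewrite sumEFin big_const_seq count_predT size_edges iter_addr_0.
    by rewrite -[X in X%:E = _]mulr_natl mulrCA.
  move=> p pe; rewrite EFinM -laplace_defectE//.
  under eq_integral do rewrite EFinM.
  rewrite ge0_integralZl_EFin//.
  + congr (_ * _)%E.
    apply: (@same_law_integral (fun y => 1 - expR (- (eps^-1 * y))) p) => //.
    by move=> y y0; have /andP[] := exp_bounds ie y0.
  + move=> w _; rewrite lee_fin.
    by have /andP[] := exp_bounds ie (divr_ge0 (normr_ge0 (J p.1 p.2 w)) (ltW b0)).
  + apply/measurable_EFinP.
    exact: (measurableT_comp (measurable_defect eps^-1) (mJ p)).
- by move=> p; apply/measurable_EFinP.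
- by move=> p w _; rewrite lee_fin; have /andP[] := small_part_term p w.
Qed.

Let S_ge0 w : 0 <= S w.
Proof. by rewrite divr_ge0 ?(ltW b0)//; apply: sumr_ge0. Qed.

Let Y_ge0 w : 0 <= Y w.
Proof. by rewrite mulr_ge0 ?invr_ge0 ?(ltW b0)// ln_partition_ge0. Qed.

Let error (w : T) : R := k * (N%:R / b * ln 2) + small_part w + collisions w.

Let small_part_bounds w : 0 <= small_part w <= 4 * k * beta * eps *+ M.
Proof.
apply/andP; split; first by apply: sumr_ge0 => p _; have /andP[] := small_part_term p w.
rewrite /M -size_edges -iter_addr_0 -count_predT -big_const_seq.
by apply: ler_sum => p _; have /andP[] := small_part_term p w.
Qed.

Let collisions_le w : collisions w <= (2 * N)%:R *+ M.
Proof.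
rewrite /M -size_edges -iter_addr_0 -count_predT -big_const_seq.
apply: ler_sum => p _.
apply: (@le_trans _ _ (\sum_(q <- edges N | adjacent p q) 1)).
  by apply: ler_sum => q _; rewrite mulr_ile1.
by rewrite big_const_seq iter_addr_0 ler_nat count_adjacent.
Qed.

(** Two adjacent couplings that are both large contribute at least one to the
    number of collisions; without collision the matching hypotheses of the
    deterministic comparison hold. *)
Let dist_exp_le_error w : `|expR (- (k * Y w)) - expR (- (k * (beta * S w)))| <= error w.
Proof.
have e01 y : 0 <= y -> 0 <= expR (- (k * y)) <= 1.
  by move=> y0; rewrite expR_ge0 expR_le1 oppr_le0 mulr_ge0// ltW.
have bS : 0 <= beta * S w by rewrite mulr_ge0// ltW.
have nb : 0 <= k * (N%:R / b * ln 2).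
  by rewrite !mulr_ge0 ?invr_ge0 ?(ltW k0) ?(ltW b0) ?ln_ge0 ?ler1n.
have /andP[sp0 _] := small_part_bounds w; have cw0 := collisions_ge0 w.
have [c1|c1] := leP 1 (collisions w).
  apply: (@le_trans _ _ 1); last by rewrite /error; lra.
  have /andP[? ?] := e01 _ (Y_ge0 w); have /andP[? ?] := e01 _ bS.
  by rewrite ler_norml; apply/andP; split; lra.
pose x i j := J i j w.
have noadj p q : large_edge x b eps p.1 p.2 -> large_edge x b eps q.1 q.2 ->
    adjacent p q -> False.
  move=> /andP[p12 px] /andP[q12 qx] pq.
  move: c1; apply/negP; rewrite -leNgt /collisions.
  rewrite (bigD1_seq p) ?mem_edges ?edges_uniq//=.
  rewrite [X in X + _]big_mkcond (bigD1_seq q) ?mem_edges ?edges_uniq//=.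
  rewrite pq.
  have ex y : eps < y -> exceeds y = 1 by move=> ey; rewrite /exceeds indicE mem_set.
  rewrite (ex _ px) (ex _ qx) mulr1 -addrA lerDl addr_ge0// sumr_ge0//.
  - by move=> r _; case: ifP => // _; rewrite mulr_ge0.
  - by move=> r _; apply: sumr_ge0 => ? _; rewrite mulr_ge0.
have H : `|Y w - beta * S w| <= N%:R / b * ln 2 + 2 * beta * \sum_(p <- edges N)
      2 * eps * (1 - expR (- (eps^-1 * (`|x p.1 p.2| / b)))).
  apply: ln_partition_approx => //.
  - move=> i j l li lj; apply/eqP/negPn/negP => ij.
    apply: (noadj (i, l) (j, l)) => //; rewrite /adjacent/= eqxx/= andbT.
    by apply/eqP => -[] /eqP; exact/negP.
  - move=> i j l li lj; apply: (noadj (i, j) (j, l)) => //.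
    rewrite /adjacent/= eqxx orbT andbT; apply/eqP => -[ij _].
    by move: li => /andP[]; rewrite ij ltnn.
apply: (@le_trans _ _ (k * `|Y w - beta * S w|)); last first.
  apply: le_trans (ler_wpM2l (ltW k0) H) _.
  rewrite mulrDr /error -addrA lerD2l.
  apply: (@le_trans _ _ (small_part w)); last by rewrite lerDl.
  rewrite le_eqVlt; apply/orP; left; apply/eqP.
  by rewrite /small_part !mulr_sumr; apply: eq_bigr => p _; rewrite /x; ring.
have lip (u v : R) : 0 <= u -> u <= v ->
    `|expR (- (k * u)) - expR (- (k * v))| <= k * `|u - v|.
  move=> u0 uv; have := expR_ge1Dx (- (k * (v - u))).
  have /andP[_ u1] := e01 u u0.
  have -> : expR (- (k * v)) = expR (- (k * u)) * expR (- (k * (v - u))).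
    by rewrite -expRD; congr expR; ring.
  have vu0 : 0 <= k * (v - u) by rewrite mulr_ge0 ?subr_ge0// ltW.
  have : expR (- (k * (v - u))) <= 1 by rewrite expR_le1 oppr_le0.
  have : 0 <= expR (- (k * u)) by rewrite expR_ge0.
  rewrite [`|u - v|]distrC [`|v - u|]ger0_norm ?subr_ge0//.
  move: (expR (- (k * u))) u1 (expR (- (k * (v - u)))) => p p1 q p0 q1 qd.
  by rewrite ger0_norm; nra.
have [uv|/ltW uv] := leP (Y w) (beta * S w); first exact: lip.
by rewrite distrC [`|Y w - _|]distrC; exact: lip.
Qed.

(** Expectation of the deterministic comparison. When [N] tends to infinity, the
    entropy term and the collisions vanish, while the middle term tends to a
    quantity of order [eps `^ (1 - alpha)]. *)
Lemma laplace_comparison :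
  `|\int[P]_w expR (- (k * Y w)) - (1 - laplace_defect (k * beta)) ^+ M| <=
  k * (N%:R / b * ln 2) + 4 * k * beta * eps * (M%:R * laplace_defect eps^-1) +
  2 * M%:R * N%:R * exceedance ^+ 2.
Proof.
have mY : measurable_fun [set: T] (fun w => expR (- (k * Y w))).
  apply: measurableT_comp => //; apply: measurable_funN; apply: measurable_funM => //.
  exact: measurable_normalized_log_partition.
have mS : measurable_fun [set: T] (fun w => expR (- (k * (beta * S w)))).
  apply: measurableT_comp => //; apply: measurable_funN; apply: measurable_funM => //.
  apply: measurable_funM => //; apply: measurable_funM => //.
  by apply: measurable_sum => p; exact: measurableT_comp.
have msp : measurable_fun [set: T] small_part by exact: measurable_sum.
have merr : measurable_fun [set: T] error.
  by apply: measurable_funD; [exact: measurable_funD|exact: measurable_collisions].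
have e01 y : 0 <= y -> `|expR (- (k * y))| <= 1.
  by move=> y0; rewrite ger0_norm ?expR_ge0// expR_le1 oppr_le0 mulr_ge0// ltW.
have nb : 0 <= k * (N%:R / b * ln 2).
  by rewrite !mulr_ge0 ?invr_ge0 ?(ltW k0) ?(ltW b0) ?ln_ge0 ?ler1n.
rewrite -laplace_total_coupling ?mulr_gt0//.
under [X in _ - X]eq_Rintegral do rewrite -mulrA -/(S _).
apply: (@le_trans _ _ (\int[P]_w error w)).
  apply: (@dist_Rintegral_le _ _ _ _ _ _ _ 1 1
    (k * (N%:R / b * ln 2) + 4 * k * beta * eps *+ M + (2 * N)%:R *+ M)) => //.
  - by move=> w; exact: e01.
  - by move=> w; apply: e01; rewrite mulr_ge0// ltW.
  - move=> w; have /andP[s0 s1] := small_part_bounds w.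
    rewrite ger0_norm; last by rewrite !addr_ge0// collisions_ge0.
    by rewrite /error !lerD// collisions_le.
rewrite /Rintegral -lee_fin fineK; last first.
  rewrite integrable_fin_num//; apply: (@integrable_bounded _ _ _ _ _
    (k * (N%:R / b * ln 2) + 4 * k * beta * eps *+ M + (2 * N)%:R *+ M)) => //.
  move=> w; have /andP[s0 s1] := small_part_bounds w.
  rewrite ger0_norm; last by rewrite !addr_ge0// collisions_ge0.
  by rewrite /error !lerD// collisions_le.
rewrite /error.
under eq_integral do rewrite !EFinD.
rewrite ge0_integralD//.
- rewrite ge0_integralD//.
  + rewrite integral_cst//= probability_setT mule1 integral_small_part !EFinD.
    by rewrite leeD2l// integral_collisions.
  + by move=> w _; rewrite lee_fin; have /andP[] := small_part_bounds w.
  + exact/measurable_EFinP.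
- by move=> w _; rewrite -EFinD lee_fin addr_ge0//; have /andP[] := small_part_bounds w.
- by apply: emeasurable_funD => //; exact/measurable_EFinP.
- by move=> w _; rewrite lee_fin collisions_ge0.
- by apply/measurable_EFinP; exact: measurable_collisions.
Qed.

End finite_size.

(** * Passage to infinite size *)

Section power_limit.
Context (R : realType).

Lemma dist_exprn_le (x y : R) (n : nat) : 0 <= x <= 1 -> 0 <= y <= 1 ->
  `|x ^+ n - y ^+ n| <= n%:R * `|x - y|.
Proof.
move=> /andP[x0 x1] /andP[y0 y1]; elim: n => [|n IH].
  by rewrite !expr0 subrr normr0 mul0r.
rewrite (_ : _ - _ = x * (x ^+ n - y ^+ n) + (x - y) * y ^+ n); last first.
  by rewrite !exprS; ring.
apply: le_trans (ler_normD _ _) _; rewrite !normrM (ger0_norm x0).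
rewrite -natr1 mulrDl mul1r lerD//.
  by apply: le_trans IH; rewrite ler_piMl.
by rewrite ler_piMr// ger0_norm ?exprn_ge0// exprn_ile1.
Qed.

Lemma dist_one_sub_expR_le (m : R) : 0 <= m <= 1 ->
  `|1 - m - expR (- m)| <= m ^+ 2.
Proof.
move=> /andP[m0 m1]; have h1 := expR_ge1Dx (- m).
have m1' : 0 < 1 + m by rewrite ltr_pwDl.
have h2 : expR (- m) <= (1 + m)^-1.
  by rewrite expRN lef_pV2 ?posrE ?expR_gt0// expR_ge1Dx.
have h3 : (1 + m)^-1 <= 1 - m + m ^+ 2.
  by rewrite -div1r ler_pdivrMr//; nra.
by rewrite ler_norml; apply/andP; split; lra.
Qed.

(** [1 - m n] differs from [expR (- m n)] by at most [m n ^+ 2], and this happens in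
    [n] factors. *)
Lemma cvg_one_sub_exprn (m : nat -> R) (c : R) :
  (\forall n \near \oo, 0 <= m n <= 1) -> n%:R * m n @[n --> \oo] --> c ->
  (1 - m n) ^+ n @[n --> \oo] --> expR (- c).
Proof.
move=> m01 mc.
have e : expR (- (n%:R * m n)) @[n --> \oo] --> expR (- c).
  by apply: cvg_comp; [apply: cvgN; exact: mc|exact: continuous_expR].
have inv0 : n%:R^-1 @[n --> \oo] --> (0 : R).
  by rewrite -cvg_shiftS; exact: cvg_harmonic.
have z : n%:R * m n * (n%:R * m n) / n%:R @[n --> \oo] --> (0 : R).
  by rewrite -[0](mulr0 (c * c)); apply: cvgM => //; exact: cvgM.
suff d : (1 - m n) ^+ n - expR (- (n%:R * m n)) @[n --> \oo] --> (0 : R).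
  rewrite -[expR (- c)]add0r; apply: cvg_trans (cvgD d e).
  by apply: near_eq_cvg; apply: nearW => n /=; rewrite subrK.
apply/cvgr0Pnorm_le => eps eps0.
near=> n; have mn : 0 <= m n <= 1 by near: n.
have /andP[m0 m1] := mn.
have n0 : 0 < n%:R :> R by near: n; exact: nbhs_infty_gtr.
rewrite -mulrN expRM_natl; apply: le_trans (dist_exprn_le _ _ _) _.
- by apply/andP; split; lra.
- by rewrite expR_ge0 expR_le1 oppr_le0.
apply: (@le_trans _ _ (n%:R * m n ^+ 2)); first by rewrite ler_pM2l// dist_one_sub_expR_le.
rewrite (_ : _ * _ = n%:R * m n * (n%:R * m n) / n%:R); last by field; rewrite gt_eqF.
apply: le_trans (ler_norm _) _; near: n; exact: (cvgr0_norm_le _ z _ eps0).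
Unshelve. all: by end_near. Qed.

Lemma cvg_div_bin2 : n%:R / 'C(n, 2)%:R @[n --> \oo] --> (0 : R).
Proof.
have h0 : 2 * harmonic n @[n --> \oo] --> (2 * 0 : R).
  by apply: cvgM; [exact: cvg_cst|exact: cvg_harmonic].
rewrite mulr0 in h0; rewrite -(cvg_shiftn 2); apply: cvg_trans h0.
apply: near_eq_cvg; apply: nearW => n /=.
have /(congr1 (fun q => q%:R : R)) := mul_predn_bin2 (n + 2).
have C0 : 'C(n + 2, 2)%:R != 0 :> R by rewrite pnatr_eq0 -lt0n bin_gt0 addn2.
rewrite addn2/= !natrM -addn2 => h.
have n0 : n.+1%:R != 0 :> R by [].
by apply: (mulfI n0); rewrite mulrCA mulrV ?unitfE// mulr1 mulrA [_ * (n + 2)%:R]mulrC h mulfK.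
Qed.

End power_limit.

Section infinite_size.
Context (R : realType) (alpha beta : R).
Hypotheses (a01 : 0 < alpha < 1) (beta0 : 0 < beta).
Context (d0 : measure_display) (T0 : measurableType d0) (P0 : probability T0 R)
  (X : {RV P0 >-> R}) (L : R -> R).
Hypothesis L_gt0 : forall x : R, 0 < x -> 0 < L x.
Hypothesis L_slow : slowly_varying L.
Hypothesis X_tail : forall x : R, 0 < x ->
  P0 [set w | x < `|X w|] = (L x / x `^ alpha)%:E.

Let a := scaling P0 X.
Let b := scaling_ratio P0 X.
Let M (n : nat) := 'C(n, 2).

Let scaling_pairs_gt0 : \forall n \near \oo, 0 < a n /\ 0 < a (M n).
Proof.
have apos := scaling_gt0 L_gt0 X_tail.
by near=> n; split; near: n; [exact: apos|exact: (@cvg_bin2 _ apos)].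
Unshelve. all: by end_near. Qed.

Let scale_mul n : 0 < a n -> a n * b n = a (M n).
Proof. by move=> an; rewrite /b /scaling_ratio mulVKf// gt_eqF. Qed.

Lemma scaling_ratio_gt0 : \forall n \near \oo, 0 < scaling_ratio P0 X n.
Proof.
apply: filterS scaling_pairs_gt0 => n [an aM].
by rewrite /scaling_ratio mulr_gt0// invr_gt0.
Qed.

Let defect_cvg (t : R) : 0 < t ->
  (M n)%:R * laplace_defect X (a n) (b n) t @[n --> \oo] --> fine (levy_exponent alpha t).
Proof.
move=> t0.
have h := cvg_comp _ _ cvg_bin2 (laplace_tail_cvg a01 L_gt0 L_slow X_tail t0).
apply: cvg_trans h; apply: near_eq_cvg; near=> n => /=.
by rewrite /laplace_defect scale_mul//; near: n; apply: filterS scaling_pairs_gt0 => n [].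
Unshelve. all: by end_near. Qed.

Let exceedance_cvg (eps : R) : 0 < eps ->
  (M n)%:R * exceedance X (a n) (b n) eps @[n --> \oo] --> eps `^ (- alpha).
Proof.
move=> eps0.
have h := cvg_comp _ _ cvg_bin2 (abs_tail_scaling_cvg L_gt0 L_slow X_tail eps0).
apply: cvg_trans h; apply: near_eq_cvg; near=> n => /=.
have [an aM] : 0 < a n /\ 0 < a (M n) by near: n.
rewrite /exceedance scale_mul// /abs_tail; congr (_ * fine (P0 _)).
by apply/seteqP; split => w /=; rewrite ltr_pdivlMr// mulrC.
Unshelve. all: by end_near. Qed.

Let power_cvg (t : R) : 0 < t ->
  (1 - laplace_defect X (a n) (b n) t) ^+ M n @[n --> \oo] -->
    expR (- fine (levy_exponent alpha t)).
Proof.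
move=> t0; have h := laplace_tail_cvg a01 L_gt0 L_slow X_tail t0.
have apos := scaling_gt0 L_gt0 X_tail.
have h01 : \forall n \near \oo, 0 <= laplace_defect X 1 (a n) t <= 1.
  by apply: filterS apos => n an; apply: laplace_defect_bounds.
have h2 := @cvg_one_sub_exprn R (fun n => laplace_defect X 1 (a n) t) _ h01.
have {}h : n%:R * laplace_defect X 1 (a n) t @[n --> \oo] -->
    fine (levy_exponent alpha t).
  by apply: cvg_trans h; apply: near_eq_cvg; apply: nearW => n; rewrite /laplace_defect mul1r.
apply: cvg_trans (cvg_comp _ _ cvg_bin2 (h2 _ h)).
apply: near_eq_cvg; near=> n => /=.
rewrite /laplace_defect scale_mul ?mul1r//.
by near: n; apply: filterS scaling_pairs_gt0 => n [].
Unshelve. all: by end_near. Qed.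

Context (d : nat -> measure_display) (T : forall N : nat, measurableType (d N))
  (P : forall N : nat, probability (T N) R)
  (J : forall N : nat, 'I_N -> 'I_N -> {RV (P N) >-> R}).
Hypothesis Jlaw : forall N : nat, 0 < scaling P0 X N ->
  forall i j : 'I_N, (i < j)%N ->
  same_law (P N) P0 (J i j) (fun w => (scaling P0 X N)^-1 * X w).
Hypothesis Jindep : forall N : nat, 0 < scaling P0 X N ->
  mutually_independent [set p : 'I_N * 'I_N | (p.1 < p.2)%N]
    (fun p => J p.1 p.2).

(** By [laplace_comparison] the Laplace transform is, up to an error whose limit
    is of order [eps `^ (1 - alpha)], that of the total coupling. Since
    [alpha < 1], this error is made small by the choice of [eps]. *)
Lemma laplace_log_partition_cvg (k : R) : 0 < k ->
  \int[P n]_w expR (- (k * normalized_log_partition (b n) beta (@J n) w))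
    @[n --> \oo] --> expR (- fine (levy_exponent alpha (k * beta))).
Proof.
move=> k0; apply/cvgrPdist_le => e e0.
have kb : 0 < k * beta by rewrite mulr_gt0.
pose c := fine (levy_exponent alpha 1).
have c0 : 0 <= c by rewrite fine_ge0// levy_exponent_ge0.
have /andP[alpha0 alpha1] := a01.
(* [q] is the value given to [eps `^ (1 - alpha)]; it makes the limit of the error
   at most [e / 4]. *)
pose q := e / (16 * k * beta * (c + 1)).
have q0 : 0 < q by rewrite divr_gt0// !mulr_gt0//; lra.
pose eps := q `^ (1 - alpha)^-1.
have eps0 : 0 < eps by rewrite powR_gt0.
have ie0 : 0 < eps^-1 by rewrite invr_gt0.
pose r n := k * ln 2 * (n%:R / b n) +
  4 * k * beta * eps * ((M n)%:R * laplace_defect X (a n) (b n) eps^-1) +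
  2 * (n%:R / (M n)%:R) * ((M n)%:R * exceedance X (a n) (b n) eps) ^+ 2.
have rl : r n @[n --> \oo] --> k * ln 2 * 0 +
    4 * k * beta * eps * fine (levy_exponent alpha eps^-1) +
    2 * 0 * (eps `^ (- alpha)) ^+ 2.
  apply: cvgD; first apply: cvgD.
  - apply: cvgM; first exact: cvg_cst.
    exact: (scaling_ratio_cvg a01 L_gt0 L_slow X_tail).
  - by apply: cvgM; [exact: cvg_cst|exact: defect_cvg].
  - apply: cvgM; first by apply: cvgM; [exact: cvg_cst|exact: cvg_div_bin2].
    by apply: cvgM; exact: exceedance_cvg.
have small : 4 * k * beta * eps * fine (levy_exponent alpha eps^-1) <= e / 4.
  rewrite levy_exponent_scale// fineM ?levy_exponent_fin_num//= -/c.
  have -> : eps^-1 `^ alpha = q / eps.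
    have qE : q = eps `^ (1 - alpha).
      by rewrite /eps -powRrM mulVf ?powRr1 ?(ltW q0)// gt_eqF// subr_gt0.
    rewrite qE -[eps^-1]powR_inv1 ?(ltW eps0)// -powRrM.
    rewrite -powRD; last by rewrite (gt_eqF eps0) implybT.
    by congr powR; ring.
  rewrite (_ : 4 * k * beta * eps * _ = e / 4 * (c / (c + 1))); last first.
    by rewrite /q; field; rewrite !gt_eqF//; lra.
  rewrite ler_piMr//; first by rewrite divr_ge0// ltW.
  by rewrite ler_pdivrMr; lra.
rewrite mulr0 add0r mulr0 mul0r addr0 in rl.
have e2 : 0 < e / 2 by lra.
have e4 : 0 < e / 4 by lra.
have rnear : \forall n \near \oo,
    `|4 * k * beta * eps * fine (levy_exponent alpha eps^-1) - r n| <= e / 4.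
  by move/cvgrPdist_le : rl; apply.
have pnear : \forall n \near \oo,
    `|expR (- fine (levy_exponent alpha (k * beta))) -
      (1 - laplace_defect X (a n) (b n) (k * beta)) ^+ M n| <= e / 2.
  by move/cvgrPdist_le : (power_cvg kb); apply.
near=> n.
have [an aM] : 0 < a n /\ 0 < a (M n) by near: n.
have M0 : 0 < (M n)%:R :> R.
  by rewrite ltr0n bin_gt0; near: n; exact: nbhs_infty_ge.
have bn : 0 < b n by rewrite /b /scaling_ratio mulr_gt0// invr_gt0.
have H := laplace_comparison an bn (Jlaw an) (Jindep an) eps0 beta0 k0.
have rn : r n <= e / 2.
  have : `|4 * k * beta * eps * fine (levy_exponent alpha eps^-1) - r n| <= e / 4.
    by near: n.
  by rewrite ler_norml => /andP[]; move: small; lra.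
have pn : `|expR (- fine (levy_exponent alpha (k * beta))) -
    (1 - laplace_defect X (a n) (b n) (k * beta)) ^+ M n| <= e / 2.
  by near: n.
have {}H : `|\int[P n]_w expR (- (k * normalized_log_partition (b n) beta (@J n) w)) -
    (1 - laplace_defect X (a n) (b n) (k * beta)) ^+ M n| <= e / 2.
  apply: le_trans H _; apply: le_trans rn; rewrite /r /M.
  rewrite le_eqVlt; apply/orP; left; apply/eqP.
  congr (_ + _ + _); first by ring.
  by rewrite -/(M n); field; rewrite gt_eqF.
rewrite (splitr e); apply: le_trans (ler_distD _ _ _) _.
by apply: lerD; [exact: pn|rewrite distrC].
Unshelve. all: by end_near. Qed.

End infinite_size.

Theorem theorem2p11 (R : realType) (alpha beta : R)
  (halpha : 0 < alpha < 1) (hbeta : 0 < beta)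
  (d0 : measure_display) (T0 : measurableType d0) (P0 : probability T0 R)
  (X : {RV P0 >-> R}) (L : R -> R)
  (hsym : symmetric_law P0 X)
  (hLpos : forall x : R, 0 < x -> 0 < L x)
  (hLslow : slowly_varying L)
  (htail : forall x : R, 0 < x ->
     P0 [set w | x < `|X w|] = (L x / x `^ alpha)%:E)
  (d : nat -> measure_display) (T : forall N : nat, measurableType (d N))
  (P : forall N : nat, probability (T N) R)
  (J : forall N : nat, 'I_N -> 'I_N -> {RV (P N) >-> R})
  (hJlaw : forall N : nat, 0 < scaling P0 X N ->
     forall i j : 'I_N, (i < j)%N ->
     same_law (P N) P0 (J N i j) (fun w => (scaling P0 X N)^-1 * X w))
  (hJindep : forall N : nat, 0 < scaling P0 X N ->
     mutually_independent [set p : 'I_N * 'I_N | (p.1 < p.2)%N]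
       (fun p => J N p.1 p.2))
  (d' : measure_display) (T' : measurableType d') (P' : probability T' R)
  (E : nat -> {RV P' >-> R})
  (hElaw : forall (j : nat) (A : set R), measurable A ->
     distribution P' (E j) A = exponential_prob 1 A)
  (hEindep : mutually_independent [set: nat] E) :
  {ae P', forall w, (gamma_series alpha E w < +oo)%E} /\
  cvg_in_distribution
    (fun N => normalized_log_partition (scaling_ratio P0 X N) beta (J N)
       : {RV (P N) >-> R})
    (scaled_gamma_series alpha E beta : {RV P' >-> R}).
Proof.
split; first exact: (ae_gamma_series_lty halpha hElaw hEindep).
apply: cvg_in_distribution_laplace.
- apply: filterS (scaling_ratio_gt0 hLpos htail) => n bn w.
  by rewrite mulr_ge0 ?invr_ge0 ?(ltW bn)// ln_partition_ge0.
- move=> w; rewrite mulr_ge0 ?(ltW hbeta)// fine_ge0//.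
  by apply: nneseries_ge0 => *; rewrite lee_fin powR_ge0.
- move=> k k0; have k0' : 0 < k%:R :> R by rewrite ltr0n.
  rewrite [X in _ --> X](_ : _ = expR (- fine (levy_exponent alpha (k%:R * beta)))).
    exact: (laplace_log_partition_cvg halpha hbeta hLpos hLslow htail hJlaw hJindep).
  by rewrite /Rintegral (integral_exp_scaled_gamma_series halpha hElaw hEindep hbeta k0').
Qed.
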